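(* Let $F:\mathbb R^n\to\mathbb R^n$ be given by an evaluation procedure, let $K\subset\mathbb R^n$ be a compact convex neighbourhood, let $\gamma_F$ be the second-order constant of $F$ on $K$, and let $\mathring x\in K$. Assume that the tangent piecewise linearization $\lozenge_{\mathring x}F:\mathbb R^n\to\mathbb R^n$ is composed of $k$ affine functions $F_1,\dots,F_k$ with invertible linear parts $A_1,\dots,A_k$, and put $$\rho_F=\min\left\{\frac1{\|A_1^{-1}\|},\dots,\frac1{\|A_k^{-1}\|}\right\}.$$ Then for all tangent mode piecewise linearizations $\lozenge_{\mathring z}F$ and all secant mode piecewise linearizations $\lozenge_{\check z}^{\hat z}F$ with development points ($\mathring z$, respectively $\check z,\hat z$) in $K\cap B(\mathring x,\rho_F/\gamma_F)$, the mapping degree is well defined and equals that of $\lozenge_{\mathring x}F$.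
   Context: All norms are infinity norms (and the induced matrix norm); $B(x,r)$ is the open ball; $\rho_F/\gamma_F=+\infty$ if $\gamma_F=0$. Evaluation procedure. $F:\mathbb R^n\to\mathbb R^m$ (here $m=n$) is evaluated by a finite straight-line program: $v_{1-n},\dots,v_0$ are the components of $x$; for $i=1,\dots,l$ each $v_i$ is either $v_i=v_j+v_k$, or $v_i=|v_j|$, or $v_i=\varphi_i(v_j)$ with indices $j,k<i$, where each smooth univariate elemental $\varphi_i$ is defined on an open subset of $\mathbb R$ containing all values $v_j(x)$, and is differentiable there with locally Lipschitz derivative; the last $m$ values form $F(x)$. (Multiplications by constants are smooth univariate elementals; subtraction, product and quotient are rewritten using these, $u\cdot w=\tfrac14[(u+w)^2-(u-w)^2]$ and the reciprocal.) Secant model. For $\check x,\hat x$ put $\check v_i=v_i(\check x)$, $\hat v_i=v_i(\hat x)$, $\mathring v_i=(\check v_i+\hat v_i)/2$, $\mathring x=(\check x+\hat x)/2$. For $\Delta x\in\mathbb R^n$ define increments recursively: for the inputs, $\Delta v_{1-n},\dots,\Delta v_0$ are the components of $\Delta x$; $\Delta v_i=\Delta v_j+\Delta v_k$ if $v_i=v_j+v_k$; $\Delta v_i=c_{ij}\Delta v_j$ if $v_i=\varphi_i(v_j)$, with $c_{ij}=(\check v_i-\hat v_i)/(\check v_j-\hat v_j)$ if $\check v_j\ne\hat v_j$ and $c_{ij}=\varphi_i'(\mathring v_j)$ otherwise; $\Delta v_i=|\mathring v_j+\Delta v_j|-\mathring v_i$ if $v_i=|v_j|$. The vector of the last $m$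 increments is $\Delta F(\check x,\hat x;\Delta x)$, and $\lozenge_{\check x}^{\hat x}F(x)=\tfrac12(F(\check x)+F(\hat x))+\Delta F(\check x,\hat x;x-\mathring x)$ for $x\in\mathbb R^n$. Tangent model: $\lozenge_{\mathring x}F=\lozenge_{\mathring x}^{\mathring x}F$ (for an arbitrary point $\mathring x$). These models are continuous piecewise linear (piecewise affine) in $x$. Second-order constant $\gamma_F$ on $K$: start with $\beta_{x_i}=1,\gamma_{x_i}=0$ for the inputs; $\beta_v=\beta_u+\beta_w$, $\gamma_v=\gamma_u+\gamma_w$ if $v=u+w$; $\beta_v=\beta_u$, $\gamma_v=\gamma_u$ if $v=|u|$; $\beta_v=\beta_uL_K(\varphi)$, $\gamma_v=L_K(\varphi)\gamma_u+L_K(\varphi')\beta_u^2$ if $v=\varphi(u)$, where $L_K(\varphi)=\max_{x\in K}|\varphi'(u(x))|$ and $L_K(\varphi')$ is the Lipschitz constant of $\varphi'$ on $u(K)$; $\gamma_F$ is the maximum over the components of $F$. Mapping degree. A continuous function is proper if preimages of compact sets are compact. If $G:\mathbb R^n\to\mathbb R^n$ is continuous, piecewise linear and proper, then there is an integer $\deg(G)$, the degree of $G$, such that $\deg(G)=\sum_{x\in G^{-1}(y)}\operatorname{sign}\det(D_xG)$ for every regular value $y$, i.e. every $y$ such that the Jacobian $D_xG$ exists and is invertible at all $x\in G^{-1}(y)$. The degree is well defined if $G$ is proper. *)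

(* Defs.v *)
From HB Require Import structures.
From mathcomp Require Import all_boot all_order all_algebra.
From mathcomp Require Import all_classical all_reals all_analysis.

Set Implicit Arguments.
Unset Strict Implicit.
Unset Printing Implicit Defensive.
Import Order.TTheory GRing.Theory Num.Theory.
Import numFieldNormedType.Exports.
Local Open Scope ring_scope.
Local Open Scope classical_set_scope.

(* Points of R^n are row vectors, so a matrix A acts by x |-> x *m A (the
   convention of the library's jacobian 'J). The library norm on 'rV[R]_n is
   the infinity norm. *)

(* The values of [efun] outside of the open domain [edom] are irrelevant. *)
Record elemental (R : realType) := Elemental {
  edom : set R;
  efun :> R -> R;
  edom_open : open edom;
  efun_derivable : forall t, edom t -> derivable efun t 1;
  efun_derive_lipschitz : forall t, edom t ->
    exists2 U : set R, nbhs t U & [lipschitz efun^`() s | s in U]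
}.

(* All the quantities v_{1-n}, ..., v_0, v_1, ..., v_l are stored in one
   sequence, so that v_i is at position i + n - 1; the arguments of
   instructions are such positions. *)
Variant instr (R : realType) : Type :=
| Add of nat & nat
| Abs of nat
| Smooth of elemental R & nat.
Arguments Add {R} _ _.
Arguments Abs {R} _.

Definition instr_args (R : realType) (c : instr R) : seq nat :=
  match c with
  | Add j k => [:: j; k]
  | Abs j => [:: j]
  | Smooth _ j => [:: j]
  end.

(* Forward sweep: each instruction appends one item, computed from the
   sequence of all the previous ones. *)
Definition sweep (R : realType) (T : Type) (next : seq T -> instr R -> T)
    (inputs : seq T) (p : seq (instr R)) : seq T :=
  foldl (fun vs c => rcons vs (next vs c)) inputs p.

Definition coords (R : realType) (n : nat) (x : 'rV[R]_n) : seq R :=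
  [seq x ord0 i | i <- enum 'I_n].

Definition next_value (R : realType) (vs : seq R) (c : instr R) : R :=
  match c with
  | Add j k => vs`_j + vs`_k
  | Abs j => `|vs`_j|
  | Smooth phi j => phi vs`_j
  end.

Definition values (R : realType) (n : nat) (p : seq (instr R))
    (x : 'rV[R]_n) : seq R :=
  sweep (@next_value R) (coords x) p.

Record evaluation_procedure (R : realType) (n m : nat) := EvaluationProcedure {
  instrs :> seq (instr R);
  instrs_args : forall i, (i < size instrs)%N ->
    forall j, j \in instr_args (nth (Add 0 0) instrs i) -> (j < n + i)%N;
  instrs_dom : forall i phi j, (i < size instrs)%N ->
    nth (Add 0 0) instrs i = Smooth phi j ->
    forall x : 'rV[R]_n, edom phi (values instrs x)`_j;
  instrs_outputs : (m <= n + size instrs)%N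
}.

Definition last_items (R : realType) (m : nat) (vs : seq R) : 'rV[R]_m :=
  \row_(i < m) vs`_(size vs - m + i).

Definition evaluate (R : realType) (n m : nat) (P : evaluation_procedure R n m)
    (x : 'rV[R]_n) : 'rV[R]_m :=
  last_items m (values P x).

Definition slope (R : realType) (phi : elemental R) (a b : R) : R :=
  if a != b then (phi a - phi b) / (a - b) else phi^`() ((a + b) / 2).

(* [vc] and [vh] are the values at the two development points; since [dv]
   holds the increments computed so far, the current position is [size dv]. *)
Definition next_increment (R : realType) (vc vh : seq R) (dv : seq R)
    (c : instr R) : R :=
  let mid i := (vc`_i + vh`_i) / 2 in
  match c with
  | Add j k => dv`_j + dv`_k
  | Abs j => `|mid j + dv`_j| - mid (size dv)
  | Smooth phi j => slope phi vc`_j vh`_j * dv`_j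
  end.

Definition increment (R : realType) (n m : nat)
    (P : evaluation_procedure R n m) (xc xh dx : 'rV[R]_n) : 'rV[R]_m :=
  last_items m
    (sweep (next_increment (values P xc) (values P xh)) (coords dx) P).

Definition secant_model (R : realType) (n m : nat)
    (P : evaluation_procedure R n m) (xc xh x : 'rV[R]_n) : 'rV[R]_m :=
  2^-1 *: (evaluate P xc + evaluate P xh)
  + increment P xc xh (x - 2^-1 *: (xc + xh)).

Definition tangent_model (R : realType) (n m : nat)
    (P : evaluation_procedure R n m) (xo : 'rV[R]_n) : 'rV[R]_n -> 'rV[R]_m :=
  secant_model P xo xo.

(* [0 <= L] matters when [A] has at most one point. *)
Definition lipschitz_constant (R : realType) (A : set R) (f : R -> R) : R :=
  inf [set L | 0 <= L /\ L.-lipschitz_A f].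

(* The items are the pairs (beta_v, gamma_v). For compact nonempty [K] the
   supremum [L] is a maximum. *)
Definition next_constants (R : realType) (n : nat) (K : set 'rV[R]_n)
    (p : seq (instr R)) (bg : seq (R * R)) (c : instr R) : R * R :=
  let beta i := (nth (0, 0) bg i).1 in
  let gamma i := (nth (0, 0) bg i).2 in
  match c with
  | Add j k => (beta j + beta k, gamma j + gamma k)
  | Abs j => (beta j, gamma j)
  | Smooth phi j =>
      let u x := (values p x)`_j in
      let L := sup [set `|phi^`() (u x)| | x in K] in
      let L' := lipschitz_constant [set u x | x in K] phi^`() in
      (beta j * L, L * gamma j + L' * beta j ^+ 2)
  end.

Definition constants (R : realType) (n : nat) (K : set 'rV[R]_n)
    (p : seq (instr R)) : seq (R * R) :=
  sweep (next_constants K p) (nseq n (1, 0)) p.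

Definition second_order_constant (R : realType) (n m : nat)
    (P : evaluation_procedure R n m) (K : set 'rV[R]_n) : R :=
  let gammas := last_items m [seq bg.2 | bg <- constants K P] in
  \big[Num.max/0]_(i < m) gammas ord0 i.

Definition induced_norm (R : realType) (n : nat) (A : 'M[R]_n) : R :=
  sup [set `|x *m A| | x in [set x : 'rV[R]_n | `|x| <= 1]].

(* Continuous selections of affine functions: the family may contain functions
   that are not active anywhere. *)
Definition composed_of (R : realType) (n m k : nat)
    (G : 'rV[R]_n -> 'rV[R]_m) (A : 'I_k -> 'M[R]_(n, m))
    (b : 'I_k -> 'rV[R]_m) : Prop :=
  continuous G /\ forall x, exists i, G x = x *m A i + b i.

Definition piecewise_affine (R : realType) (n m : nat)
    (G : 'rV[R]_n -> 'rV[R]_m) : Prop :=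
  exists (k : nat) (A : 'I_k -> 'M[R]_(n, m)) (b : 'I_k -> 'rV[R]_m),
    composed_of G A b.

(* The neutral element +oo is harmless: [k] is positive as soon as some map is
   composed of [k] functions. *)
Definition min_inv_norm (R : realType) (n k : nat) (A : 'I_k -> 'M[R]_n) :
    \bar R :=
  \big[Order.min/+oo%E]_(i < k) ((induced_norm (invmx (A i)))^-1)%:E.

Definition quotient_radius (R : realType) (rho : \bar R) (gamma : R) : \bar R :=
  if gamma == 0 then +oo%E else (rho * (gamma^-1)%:E)%E.

Definition open_ball (R : realType) (n : nat) (x : 'rV[R]_n) (r : \bar R) :
    set 'rV[R]_n :=
  [set z | (`|x - z|%:E < r)%E].

Definition proper_map (R : realType) (n m : nat)
    (G : 'rV[R]_n -> 'rV[R]_m) : Prop :=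
  continuous G /\ forall C, compact C -> compact (G @^-1` C).

Definition regular_value (R : realType) (n : nat)
    (G : 'rV[R]_n -> 'rV[R]_n) (y : 'rV[R]_n) : Prop :=
  forall x, G x = y -> differentiable G x /\ 'J G x \in unitmx.

(* [\sum_(x \in _)] is 0 on an infinite support, whence the explicit
   finiteness. *)
Definition is_degree (R : realType) (n : nat)
    (G : 'rV[R]_n -> 'rV[R]_n) (d : int) : Prop :=
  forall y, regular_value G y ->
    finite_set (G @^-1` [set y]) /\
    d = \sum_(x \in G @^-1` [set y]) sgz (\det ('J G x)).

Definition degree (R : realType) (n : nat) (G : 'rV[R]_n -> 'rV[R]_n) : int :=
  xget 0 [set d | is_degree G d].

Definition degree_well_defined (R : realType) (n : nat)
    (G : 'rV[R]_n -> 'rV[R]_n) : Prop :=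
  [/\ piecewise_affine G, proper_map G & exists! d, is_degree G d].

(* Main.v *)
(** The recursion that defines [gamma_F] bounds the linear growth of the
    difference of two models: if the development points [zc], [zh] are within
    [r] of [xo], then [|S x - T x| <= gamma_F r |x| + C] for the secant model
    [S] and the tangent model [T]. As [|T x| >= rho_F |x| - C'] and
    [gamma_F r < rho_F], all the maps [T + t (S - T)] with [0 <= t <= 1] grow
    at least linearly, and the degree is constant along this homotopy.

    The degree of a continuous piecewise affine map [G] of linear growth is
    obtained from three facts about [N(G, y)], the sum of the signs of the
    Jacobian determinants over the preimages of [y]. First, [N(G + t D, y)] is
    constant for small [t] when [D] is affine near every preimage of the regular
    value [y]. Second, if all the linear parts of [G] are invertible, then
    [N(G, .)] does not change along a segment that avoids the images of the
    intersections of two walls: at a wall the linear parts of the two adjacent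
    cells differ by a rank one matrix, so their determinants have the same sign
    exactly when the preimage passes through the wall. Third, [G + t id] has
    invertible linear parts for all small [t > 0], which removes the
    assumption of invertibility. *)

Require Import Defs.
From mathcomp Require Import all_boot all_order all_algebra ring lra.
From mathcomp Require Import all_classical all_reals all_analysis.
Import Order.TTheory GRing.Theory Num.Theory.
Import numFieldNormedType.Exports.
Local Open Scope ring_scope.
Local Open Scope classical_set_scope.

Set Implicit Arguments.
Unset Strict Implicit.
Unset Printing Implicit Defensive.

(** A continuous selection comes without a polyhedral subdivision, so one has to be built. Its walls
    are the hyperplanes on which one coordinate of two pieces coincides. They are taken coordinate
    by coordinate because the coincidence set of two whole pieces can have any dimension. Off the
    walls, continuity leaves a single active piece per cell. Regular values are defined by
    differentiability only, so several pieces may be active at a preimage. Differentiability of a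
    selection forces exact affineness nearby, which turns local inversion into linear algebra. To
    follow a moving value, the preimage set is replaced by a fixed finite family: each nonempty cell
    contributes the solution of its own piece, even when that solution lies outside the cell, with a
    weight that detects membership. Changes of weight can then occur only for cells whose solution
    reaches a wall, and they cancel between the two neighbours across that wall. *)

(** * Norm estimates, avoidance of finitely many hyperplanes, a gap argument *)

Lemma ler_coord_norm (R : realType) (n : nat) (x : 'rV[R]_n) i :
  `|x ord0 i| <= `|x|.
Proof.
have := le_bigmax (0 : R) (fun ij : 'I_1 * 'I_n => `|x ij.1 ij.2|) (ord0, i).
by rewrite -mx_normrE.
Qed.

Lemma ler_norm_coord (R : realType) (n : nat) (x : 'rV[R]_n) (c : R) :
  0 <= c -> (forall i, `|x ord0 i| <= c) -> `|x| <= c.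
Proof.
move=> c0 xc; rewrite /Num.norm/= mx_normrE; apply/bigmax_leP; split => // -[i j] _ /=.
by rewrite (ord1 i).
Qed.

Lemma mulmx_bounded (R : realType) (n m : nat) (M : 'M[R]_(n, m)) :
  exists2 C : R, 0 < C & forall x : 'rV[R]_n, `|x *m M| <= C * `|x|.
Proof.
exists (1 + \sum_i \sum_j `|M i j|) => [|x].
  by rewrite ltr_pwDl// sumr_ge0// => i _; rewrite sumr_ge0.
apply: ler_norm_coord => [|j].
  by rewrite mulr_ge0// addr_ge0// sumr_ge0// => i _; rewrite sumr_ge0.
rewrite mxE (le_trans (ler_norm_sum _ _ _))// mulrDl mul1r.
apply: (@le_trans _ _ ((\sum_i \sum_j `|M i j|) * `|x|)); last by rewrite lerDr.
rewrite mulr_suml ler_sum// => i _; rewrite normrM mulrC ler_pM ?ler_coord_norm//.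
by rewrite (bigD1 j)//= lerDl sumr_ge0.
Qed.

Lemma nbhs_norm_exP (R : realType) (V : normedModType R) (x : V) (P : set V) :
  nbhs x P <-> exists2 r : R, 0 < r & forall z, `|z - x| < r -> P z.
Proof.
split=> [/nbhs_normP[r /= r0 xr]|[r r0 xr]].
  by exists r => // z zx; apply: xr => /=; rewrite distrC.
by apply/nbhs_normP; exists r => // z; rewrite /= distrC; exact: xr.
Qed.

Lemma lipschitz_continuous (R : realType) (V W : normedModType R) (f : V -> W)
    (C : R) :
  (forall x y, `|f x - f y| <= C * `|x - y|) -> continuous f.
Proof.
move=> fC x; apply/cvgrPdist_lt => e e0; apply/nbhs_norm_exP.
have C0 : 0 < `|C| + 1 by rewrite ltr_wpDl.
exists (e / (`|C| + 1)) => [|z zx]; first exact: divr_gt0.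
rewrite (le_lt_trans (fC _ _))// distrC.
apply: (@le_lt_trans _ _ ((`|C| + 1) * `|z - x|)).
  by rewrite ler_wpM2r// (le_trans (ler_norm _))// lerDl.
by rewrite mulrC -ltr_pdivlMr.
Qed.

Lemma mulmx_continuous (R : realType) (n m : nat) (M : 'M[R]_(n, m)) :
  continuous (fun x : 'rV[R]_n => x *m M).
Proof.
have [C _ MC] := mulmx_bounded M.
by apply: (@lipschitz_continuous _ _ _ _ C) => x y; rewrite -mulmxBl.
Qed.

Lemma continuous_coords (R : realType) (T : topologicalType) (n : nat)
    (f : T -> 'rV[R]_n) :
  (forall i, continuous (fun x => f x ord0 i)) -> continuous f.
Proof.
move=> fc x; apply/cvgrPdist_lt => e e0.
have : \forall z \near x, forall i, `|f x ord0 i - f z ord0 i| < e / 2.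
  apply: (@filter_forall _ _ _ (nbhs x)) => i.
  by have /cvgrPdist_lt := fc i x; apply; rewrite divr_gt0.
apply: filterS => z xz; apply: (@le_lt_trans _ _ (e / 2)); last first.
  by rewrite ltr_pdivrMr// ltr_pMr// ltr1n.
apply: ler_norm_coord => [|i]; first by rewrite divr_ge0// ltW.
by rewrite !mxE ltW.
Qed.

(** Affineness is expressed along lines, so that walls, coordinates of pieces, their pullbacks under
    inverse pieces and constants are treated alike, without a matrix form. *)
Definition affine_fun (R : realType) (n : nat) (f : 'rV[R]_n -> R) : Prop :=
  forall x y t, f (x + t *: (y - x)) = f x + t * (f y - f x).

Lemma itv_avoid (R : realType) (s : seq R) (a b : R) :
  a < b -> exists2 t, a < t < b & t \notin s.
Proof.
elim: s a b => [|c s IH] a b ab.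
  by exists ((a + b) / 2) => //; rewrite !midf_lt.
case: (boolP (a < c < b)) => [/andP[ac cb]|cab].
  have [t /andP[at_ tc] ts] := IH _ _ ac.
  by exists t; rewrite ?at_ ?(lt_trans tc)// inE negb_or lt_eqF.
have [t tab ts] := IH _ _ ab; exists t => //; rewrite inE negb_or ts andbT.
by apply: contraNN cab => /eqP <-.
Qed.

(** On the line each [f i] is either a nonzero constant or vanishes at the single parameter
    [f i y / (f i y - f i z)]; finitely many parameters are avoided. *)
Lemma affine_line_avoid (R : realType) (n : nat) (I : eqType) (s : seq I)
    (f : I -> 'rV[R]_n -> R) (y z : 'rV[R]_n) (e : R) :
  (forall i, affine_fun (f i)) ->
  (forall i, i \in s -> f i y != 0 \/ f i z != 0) -> 0 < e ->
  exists2 t, 0 < t < e & forall i, i \in s -> f i (y + t *: (z - y)) != 0.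
Proof.
move=> faff fyz e0.
have [t te tN] := itv_avoid [seq f i y / (f i y - f i z) | i <- s] e0.
exists t => // i si; rewrite faff; apply/eqP => fi0.
have [d0|d0] := eqVneq (f i y) (f i z).
  move: fi0; rewrite d0 subrr mulr0 addr0 => fz0.
  by case: (fyz _ si); rewrite ?d0 fz0 eqxx.
have dn0 : f i y - f i z != 0 by rewrite subr_eq0.
have tE : t = f i y / (f i y - f i z).
  apply: (mulIf dn0); rewrite divfK//; apply/eqP; rewrite -subr_eq0 -oppr_eq0.
  by apply/eqP; rewrite -[RHS]fi0; ring.
by case/negP: tN; rewrite tE; apply/mapP; exists i.
Qed.

(** Finitely many proper hyperplanes do not cover a ball. In the induction, the point found so far
    is moved slightly towards a point where the new function is nonzero. *)
Lemma affine_avoid (R : realType) (n : nat) (I : finType)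
    (f : I -> 'rV[R]_n -> R) (x : 'rV[R]_n) (r : R) :
  (forall i, affine_fun (f i)) -> (forall i, exists z, f i z != 0) -> 0 < r ->
  exists2 z, `|z - x| < r & forall i, f i z != 0.
Proof.
move=> faff fne r0.
suff [z zr fz] : exists2 z, `|z - x| < r & forall i, i \in enum I -> f i z != 0.
  by exists z => // i; apply: fz; rewrite mem_enum.
elim: (enum I) => [|i s [z zr fz]]; first by exists x; rewrite ?subrr ?normr0.
have [w fw] := fne i.
have e0 : 0 < (r - `|z - x|) / (1 + `|w - z|).
  by rewrite divr_gt0 ?subr_gt0// ltr_pwDl.
have [|t /andP[t0 te] ft] := @affine_line_avoid _ _ _ (i :: s) f z w _ faff _ e0.
  by move=> j; rewrite inE => /predU1P[->|/fz]; [right|left].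
exists (z + t *: (w - z)) => //; rewrite addrAC (le_lt_trans (ler_normD _ _))//.
rewrite -ltrBrDl normrZ gtr0_norm//; have wz : 0 < 1 + `|w - z| by rewrite ltr_pwDl.
rewrite ltr_pdivlMr// in te.
by apply: le_lt_trans te; rewrite ler_pM2l// lerDr.
Qed.

(** Otherwise the intermediate value [m / 2] would be attained up to sign. This is how a continuous
    selection is kept on one piece along a segment. *)
Lemma continuous_gap_eq0 (R : realType) (f : R -> R) (m : R) :
  {within `[0, 1], continuous f} -> f 0 = 0 -> 0 < m ->
  (forall s, 0 <= s <= 1 -> f s = 0 \/ m <= `|f s|) -> f 1 = 0.
Proof.
move=> fc f0 m0 fm; have [//|m1] := fm 1 (ltac:(by rewrite ler01 lexx)).
wlog f1 : f fc f0 fm m1 / m <= f 1.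
  move=> H; have [|] := lerP 0 (f 1) => f10; first by apply: H; rewrite // -[leRHS]ger0_norm.
  apply/eqP; rewrite -oppr_eq0; apply/eqP; apply: (H (fun x => - f x)) => //.
  - by move=> x; apply: (@continuousN _ _ _ _ _ (fc x)).
  - by rewrite f0 oppr0.
  - by move=> s /fm[->|]; [left; rewrite oppr0|right; rewrite normrN].
  - by rewrite normrN.
  - by rewrite -ltr0_norm.
have [|c c01 fcm] := @IVT _ f 0 1 (m / 2) ler01 fc.
  have f10 : 0 <= f 1 by exact: le_trans (ltW m0) f1.
  rewrite f0 (min_idPl f10) (max_idPr f10) divr_ge0 ?(ltW m0)//= (le_trans _ f1)//.
  by rewrite ler_pdivrMr// ler_peMr ?ler1n// ltW.
have [] := fm c; first by move: c01; rewrite in_itv.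
- by rewrite fcm => fc0; lra.
- rewrite fcm => mm; have h : 0 <= m / 2 by lra.
  by rewrite ger0_norm// in mm; lra.
Qed.

(** * Local affineness of continuous selections of affine maps *)

Definition affine_near (R : realType) (n m : nat) (G : 'rV[R]_n -> 'rV[R]_m)
    (x : 'rV[R]_n) (M : 'M[R]_(n, m)) : Prop :=
  \forall z \near x, G z = G x + (z - x) *m M.

Lemma affine_near_jacobian (R : realType) (n m : nat)
    (G : 'rV[R]_n -> 'rV[R]_m) (x : 'rV[R]_n) (M : 'M[R]_(n, m)) :
  affine_near G x M -> differentiable G x /\ 'J G x = M.
Proof.
move=> /nbhs_norm_exP[r r0 GM].
have df : G \o shift x = cst (G x) + mulmxr M +o_ (0 : 'rV[R]_n) id.
  apply/eqaddoP => e e0; apply/nbhs_norm_exP; exists r => // z.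
  rewrite subr0 => zr; rewrite !fctE /= GM; last by rewrite addrK.
  by rewrite addrK subrr normr0 mulr_ge0// ltW.
have cM : continuous (mulmxr M : 'rV[R]_n -> 'rV[R]_m).
  exact: mulmx_continuous.
have dE := diff_unique cM df.
split; first by apply/diff_locallyP; rewrite dE.
apply/row_matrixP => i; rewrite !rowE /jacobian mul_rV_lin1.
by rewrite dE.
Qed.

Lemma differentiable_norm (R : realType) (n m : nat)
    (G : 'rV[R]_n -> 'rV[R]_m) (x : 'rV[R]_n) (e : R) :
  differentiable G x -> 0 < e ->
  \forall z \near x, `|G z - G x - (z - x) *m 'J G x| <= e * `|z - x|.
Proof.
move=> /diff_locallyP[_ /eqaddoP dG] /dG /nbhs_norm_exP[r r0 rG].
apply/nbhs_norm_exP; exists r => // z zr.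
have := rG (z - x); rewrite subr0 => /(_ zr).
rewrite !fctE /= subrK opprD addrA.
by rewrite /jacobian mul_rV_lin1.
Qed.

Lemma near_forall_mem (T : eqType) (U : Type) (s : seq T) (F : set_system U)
    {FF : Filter F} (P : T -> U -> Prop) :
  (forall x, x \in s -> \forall u \near F, P x u) ->
  \forall u \near F, forall x, x \in s -> P x u.
Proof.
elim: s => [_|x s IH sP]; first by apply: nearW.
have := IH (fun y ys => sP y (mem_behead (s := x :: s) ys)).
apply: filterS2 (sP x (mem_head _ _)) => u Px Ps y.
by rewrite inE => /predU1P[->//|/Ps].
Qed.

Lemma finite_gap (R : realType) (I : finType) (v : I -> R) :
  exists2 m, 0 < m & forall i, v i = 0 \/ m <= `|v i|.
Proof.
exists (\big[Num.min/1]_(i | v i != 0) `|v i|).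
  by apply: lt_bigmin => [|i]; [exact: ltr01|rewrite normr_gt0].
move=> i; have [->|vi] := eqVneq (v i) 0; [by left|right].
exact: bigmin_le_cond.
Qed.

Lemma affine_increment (R : realType) (n m : nat) (A J : 'M[R]_(n, m))
    (b : 'rV[R]_m) (x h : 'rV[R]_n) (t : R) :
  (x + t *: h) *m A + b - (x *m A + b) - (t *: h) *m J = t *: (h *m (A - J)).
Proof.
rewrite mulmxDl -!scalemxAl mulmxBr.
move: (x *m A) (h *m A) (h *m J) => u v w.
by apply/rowP => j; rewrite !mxE; ring.
Qed.

(** A piece that differs from [G] at [x] still differs from it near [x], by continuity; so only
    pieces active at [x] occur nearby. *)
Lemma composed_active (R : realType) (n m k : nat) (G : 'rV[R]_n -> 'rV[R]_m)
    (A : 'I_k -> 'M[R]_(n, m)) (b : 'I_k -> 'rV[R]_m) (x : 'rV[R]_n) :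
  composed_of G A b -> \forall z \near x,
    exists2 i, G x = x *m A i + b i & G z = z *m A i + b i.
Proof.
move=> [Gc GAb].
have : \forall z \near x, forall i, G z = z *m A i + b i -> G x = x *m A i + b i.
  apply: (@filter_forall _ _ _ (nbhs x)) => i.
  have [Gx|/eqP Gx] := pselect (G x = x *m A i + b i); first exact: nearW.
  have hc : {for x, continuous (fun z => `|G z - (z *m A i + b i)|)}.
    apply: continuous_comp; last exact: norm_continuous.
    apply: continuousB; first exact: Gc.
    by apply: continuousD; [exact: mulmx_continuous|exact: cst_continuous].
  have := @cvgr_gt _ _ _ _ _ _ hc 0; rewrite normr_gt0 subr_eq0 => /(_ _ Gx).
  by apply: filterS => z + Gz; rewrite Gz subrr normr0 ltxx.
by apply: filterS => z zx; have [i Gz] := GAb z; exists i => //; apply: zx.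
Qed.

(** On the segment from [x] to [z], each coordinate of the difference quotient of [G] minus its
    differential is continuous in the parameter and takes values in a finite set. Close to [x] it is
    smaller than the gap of that set around 0, hence 0, and it stays 0 up to [z]. *)
Lemma composed_linear_near (R : realType) (n m k : nat)
    (G : 'rV[R]_n -> 'rV[R]_m) (A : 'I_k -> 'M[R]_(n, m)) (b : 'I_k -> 'rV[R]_m)
    (x : 'rV[R]_n) :
  composed_of G A b -> differentiable G x -> affine_near G x ('J G x).
Proof.
move=> GAb dG; have [r r0 rG] := (nbhs_norm_exP _ _).1 (composed_active x GAb).
apply/nbhs_norm_exP; exists r => // z zr.
set J := 'J G x; set h := z - x.
apply/eqP; rewrite -subr_eq0; apply/eqP/rowP => c.
have [g g0 gv] := finite_gap (fun i => (h *m (A i - J)) ord0 c).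
have h1 : 0 < 1 + `|h| by rewrite ltr_pwDl.
have e0 : 0 < g / 2 / (1 + `|h|) by rewrite !divr_gt0.
have [d d0 dJ] := (nbhs_norm_exP _ _).1 (differentiable_norm dG e0).
(* [t0] is where differentiability is used: [x + t0 *: h] lies within [d] of [x], and [e0] was
   chosen to push the quotient there below the gap [g]. *)
pose t0 := Num.min (1 / 2) (d / 2 / (1 + `|h|)).
have t00 : 0 < t0 by rewrite lt_min !divr_gt0.
have t01 : t0 < 1 by rewrite gt_min ltr_pdivrMr// mul1r ltr1n.
have t0d : t0 * `|h| < d.
  apply: (@le_lt_trans _ _ (d / 2)); last by rewrite ltr_pdivrMr// ltr_pMr// ltr1n.
  apply: (@le_trans _ _ (t0 * (1 + `|h|))).
    by rewrite ler_wpM2l ?lerDr// ltW.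
  by rewrite -ler_pdivlMr// ge_min lexx orbT.
(* The parameter runs over [[t0, 1]], away from the singularity of the quotient at 0. *)
pose tau s := t0 + s * (1 - t0).
have tau0 s : 0 <= s -> 0 < tau s.
  by move=> s0; rewrite ltr_pwDl// mulr_ge0// subr_ge0 ltW.
have tau1 s : 0 <= s <= 1 -> tau s <= 1.
  by move=> /andP[s0 s1]; rewrite /tau; nra.
pose q s := (G (x + tau s *: h) - G x - (tau s *: h) *m J) ord0 c / tau s.
have qE s : 0 <= s <= 1 -> exists i, q s = (h *m (A i - J)) ord0 c.
  move=> s01; have ts0 := tau0 _ (andP s01).1.
  have [|i Gx Gz] := rG (x + tau s *: h).
    rewrite addrAC subrr add0r normrZ gtr0_norm// (le_lt_trans _ zr)//.
    by rewrite ler_piMl// tau1.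
  exists i; rewrite /q Gx Gz affine_increment mxE mulrAC mulfV ?mul1r//.
  by rewrite gt_eqF.
have q1 : q 1 = 0.
  apply: (continuous_gap_eq0 _ _ g0).
  - apply: continuous_in_subspaceT => s; rewrite inE /= in_itv/= => /andP[s0 _].
    have tauc : continuous tau.
      move=> u; apply: cvgD; first exact: cvg_cst.
      by apply: cvgM; [exact: cvg_id|exact: cvg_cst].
    have thc : continuous (fun u => tau u *: h).
      by move=> u; apply: cvgZl; exact: tauc.
    pose num u := G (x + tau u *: h) - G x - (tau u *: h) *m J.
    have numc : continuous num.
      move=> u; rewrite /num; apply: cvgB; first apply: cvgB.
      - apply: (@continuous_comp _ _ _ (fun u => x + tau u *: h) G _ _ (GAb.1 _)).
        by apply: cvgD; [exact: cvg_cst|exact: thc].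
      - exact: cvg_cst.
      - rewrite -scalemxAl; under eq_fun do rewrite -scalemxAl.
        by apply: cvgZl; exact: tauc.
    have numcc : continuous (fun u => num u ord0 c).
      move=> u; exact: (@continuous_comp _ _ _ num (fun v : 'rV_m => v ord0 c) _
        (numc _) (@coord_continuous _ _ _ _ _ _)).
    apply: cvgM; first exact: numcc.
    by apply: cvgV; [rewrite gt_eqF// tau0|exact: tauc].
  - have [|i q0] := qE 0; first by rewrite lexx ler01.
    have [z0|] := gv i; first by rewrite q0.
    rewrite -q0 leNgt => /negP[].
    rewrite /q /tau mul0r addr0 normrM normfV (gtr0_norm t00) ltr_pdivrMr//.
    have := dJ (x + t0 *: h); rewrite addrAC subrr add0r normrZ (gtr0_norm t00).
    move=> /(_ t0d) dJ0; apply: le_lt_trans (ler_coord_norm _ _) _.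
    apply: le_lt_trans dJ0 _; rewrite mulrCA mulrC ltr_pM2r//.
    rewrite mulrAC ltr_pdivrMr//; nra.
  - by move=> s /qE[i ->].
have tau11 : tau 1 = 1 by rewrite /tau mul1r addrC subrK.
have := q1; rewrite /q tau11 divr1 scale1r.
have -> : x + h = z by rewrite addrC subrK.
move: (h *m J) => u; rewrite !mxE.
by move=> <-; ring.
Qed.

(** Near [x] the map is affine with matrix ['J G x], yet at every point it agrees with a piece
    active at [x]. If no such piece had this matrix, the agreement sets would be contained in
    finitely many hyperplanes, which cannot cover a ball. *)
Lemma composed_jacobian (R : realType) (n m k : nat)
    (G : 'rV[R]_n -> 'rV[R]_m) (A : 'I_k -> 'M[R]_(n, m)) (b : 'I_k -> 'rV[R]_m)
    (x : 'rV[R]_n) :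
  composed_of G A b -> differentiable G x ->
  exists2 i, G x = x *m A i + b i & 'J G x = A i.
Proof.
move=> GAb dG; have [r r0 rG] := (nbhs_norm_exP _ _).1
  (filterI (composed_active x GAb) (composed_linear_near GAb dG)).
apply: contrapT => noi.
have [f f_] : {f : 'I_k -> 'rV[R]_n -> R & forall i, [/\ affine_fun (f i),
    (exists z, f i z != 0) & G x = x *m A i + b i -> forall z,
      (z - x) *m A i = (z - x) *m 'J G x -> f i z = 0]}.
  apply: (@choice _ _ (fun i fi => [/\ affine_fun fi,
    (exists z, fi z != 0) & G x = x *m A i + b i -> forall z,
      (z - x) *m A i = (z - x) *m 'J G x -> fi z = 0])) => i.
  (* A piece inactive at [x] imposes nothing, so it gets the constant function 1. *)
  have [Gx|Gx] := pselect (G x = x *m A i + b i); last first.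
    exists (fun=> 1); split=> [y z t||//]; first by rewrite subrr mulr0 addr0.
    by exists 0; rewrite oner_eq0.
  have : A i != 'J G x by apply/eqP => AJ; apply: noi; exists i.
  rewrite -subr_eq0 => /eqP AJ.
  have [l [c Alc]] : exists l c, (A i - 'J G x) l c != 0.
    apply: contrapT => no; apply: AJ; apply/matrixP => l c.
    rewrite [RHS]mxE; apply/eqP; apply: contraPT no => lc; apply.
    by exists l, c.
  exists (fun z => ((z - x) *m (A i - 'J G x)) ord0 c); split.
  - move=> y z t; rewrite addrAC mulmxDl -scalemxAl.
    have -> : z - y = (z - x) - (y - x) by rewrite opprB addrA subrK.
    by rewrite [(z - x - (y - x)) *m _]mulmxBl !mxE.
  - by exists (x + delta_mx 0 l); rewrite addrAC subrr add0r -rowE mxE.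
  - by move=> _ z zAJ; rewrite mulmxBr zAJ subrr mxE.
have faff i : affine_fun (f i) by case: (f_ i).
have fne i : exists z, f i z != 0 by case: (f_ i).
have [z zr fz] := affine_avoid x faff fne r0.
have [[i Gx Gz] Gxz] := rG z zr.
have [_ _ /(_ Gx z) fi0] := f_ i; case/eqP: (fz i); apply: fi0.
rewrite mulmxBl; apply: (addrI (G x)); rewrite -Gxz Gz Gx.
by move: (z *m A i) (x *m A i) => u v; apply/rowP => j; rewrite !mxE; ring.
Qed.

(** * Stability of the sum of the signs at a regular value *)

(** Linear growth rather than mere properness: it survives small perturbations of at most linear
    growth, and it implies properness for continuous maps. *)
Definition coercive (R : realType) (n m : nat) (G : 'rV[R]_n -> 'rV[R]_m) :
    Prop :=
  exists c C : R, 0 < c /\ forall x, c * `|x| <= `|G x| + C.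

Definition linearly_bounded (R : realType) (n m : nat)
    (G : 'rV[R]_n -> 'rV[R]_m) : Prop :=
  exists C : R, 0 <= C /\ forall x, `|G x| <= C * (`|x| + 1).

(** The number [N(G, y)]. Finiteness of the preimage is always established separately. *)
Definition index_sum (R : realType) (n : nat) (G : 'rV[R]_n -> 'rV[R]_n)
    (y : 'rV[R]_n) : int :=
  \sum_(x \in G @^-1` [set y]) sgz (\det ('J G x)).

Lemma unitmx_sgz (R : realType) (n : nat) (M : 'M[R]_n) :
  (M \in unitmx) = (sgz (\det M) != 0).
Proof. by rewrite unitmxE unitfE sgz_eq0. Qed.

(** The determinant is a polynomial in [t], hence continuous, and it is nonzero at 0. *)
Lemma sgz_det_near (R : realType) (n : nat) (M P : 'M[R]_n) :
  M \in unitmx -> \forall t \near (0 : R), sgz (\det (M + t *: P)) = sgz (\det M).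
Proof.
rewrite unitmxE unitfE => M0.
pose p := \det (map_mx polyC M + 'X *: map_mx polyC P).
have pE t : \det (M + t *: P) = p.[t].
  rewrite -[p.[t]]/(horner_eval t p) -det_map_mx; congr (\det _).
  by apply/matrixP => i j; rewrite !mxE /= /horner_eval hornerD hornerM hornerX !hornerC.
have p0 : p.[0] = \det M by rewrite -pE scale0r addr0.
have pc : {for (0 : R), continuous (horner p)} := @continuous_horner _ _ _.
have [Mp|Mn|/eqP] := ltrgt0P (\det M); last by rewrite (negPf M0).
- have := @cvgr_gt _ _ _ _ _ _ pc 0; rewrite p0 => /(_ _ Mp).
  by apply: filterS => t; rewrite pE => pt; rewrite !gtr0_sgz.
- have := @cvgr_lt _ _ _ _ _ _ pc 0; rewrite p0 => /(_ _ Mn).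
  by apply: filterS => t; rewrite pE => pt; rewrite !ltr0_sgz.
Qed.

(** Here [u] is the displacement of a preimage under perturbation. From
    [u *m M = - t *: (d + u *m P)], the term in [u] on the right is absorbed into [u / 2] for small
    [t]. *)
Lemma solution_near (R : realType) (n : nat) (M P : 'M[R]_n) (d : 'rV[R]_n)
    (r : R) : M \in unitmx -> 0 < r ->
  \forall t \near (0 : R), forall u, u *m (M + t *: P) = - (t *: d) -> `|u| < r.
Proof.
move=> Mu r0.
have [C1 C10 C1P] := mulmx_bounded (invmx M).
have [C2 C20 C2P] := mulmx_bounded P.
have e0 : 0 < Num.min (1 / (2 * C1 * C2)) (r / (4 * C1 * (1 + `|d|))).
  by rewrite lt_min !divr_gt0 ?mulr_gt0// ltr_pwDl.
apply/nbhs_norm_exP; exists (Num.min (1 / (2 * C1 * C2)) (r / (4 * C1 * (1 + `|d|)))).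
  exact: e0.
move=> t; rewrite subr0 lt_min => /andP[t1 t2] u uE.
have uM : u *m M = - (t *: (d + u *m P)).
  by rewrite scalerDr opprD -uE mulmxDr -scalemxAr addrK.
have ule : `|u| <= C1 * (`|t| * (`|d| + C2 * `|u|)).
  rewrite -[u in leLHS](mulmxK Mu) (le_trans (C1P _))// ler_pM2l// uM normrN.
  rewrite normrZ ler_wpM2l// (le_trans (ler_normD _ _))// lerD2l.
  exact: C2P.
have h2 : `|t| * (2 * C1 * C2) < 1 by rewrite -ltr_pdivlMr// !mulr_gt0.
have h3 : `|t| * (4 * C1 * (1 + `|d|)) < r.
  by rewrite -ltr_pdivlMr// !mulr_gt0// ltr_pwDl.
have u0 : 0 <= `|u| := normr_ge0 u.
have d0 : 0 <= `|d| := normr_ge0 d.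
have t0 : 0 <= `|t| := normr_ge0 t.
have h4 : C1 * (`|t| * (C2 * `|u|)) <= `|u| / 2 by nra.
have h5 : C1 * (`|t| * `|d|) < r / 2 by nra.
lra.
Qed.

Lemma coercive_perturb (R : realType) (n m : nat) (G D : 'rV[R]_n -> 'rV[R]_m) :
  coercive G -> linearly_bounded D ->
  \forall t \near (0 : R), coercive (fun x => G x + t *: D x).
Proof.
move=> [c [C [c0 GC]]] [a [a0 Da]].
apply/nbhs_norm_exP; exists (c / (2 * (a + 1))).
  by rewrite divr_gt0// mulr_gt0// ltr_wpDl.
move=> t; rewrite subr0 ltr_pdivlMr ?mulr_gt0 ?ltr_wpDl// => t1.
exists (c / 2), (C + `|t| * a); split; first by rewrite divr_gt0.
move=> x; have := GC x; have := Da x.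
have : `|G x| <= `|G x + t *: D x| + `|t| * `|D x|.
  by rewrite -normrZ -{1}[G x](addrK (t *: D x)) ler_normB.
have t0 : 0 <= `|t| := normr_ge0 t.
have x0 : 0 <= `|x| := normr_ge0 x.
move=> h1 h2 h3.
have h4 : `|t| * `|D x| <= `|t| * (a * (`|x| + 1)) by rewrite ler_wpM2l.
have h5 : `|t| * a * `|x| <= c / 2 * `|x| by rewrite ler_wpM2r//; nra.
nra.
Qed.

(** Coercivity confines all perturbed solutions to one ball. On the compact part of that ball away
    from [s], the distance from [G z] to [y] has a positive minimum, which a small perturbation
    cannot overcome. *)
Lemma zeros_near (R : realType) (n : nat) (G D : 'rV[R]_n -> 'rV[R]_n)
    (y : 'rV[R]_n) (s : seq 'rV[R]_n) (r : R) :
  continuous G -> coercive G -> linearly_bounded D -> 0 < r ->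
  G @^-1` [set y] `<=` [set` s] ->
  \forall t \near (0 : R), forall z, G z + t *: D z = y ->
    exists2 x, x \in s & `|z - x| < r.
Proof.
move=> Gc [c [C [c0 GC]]] [a [a0 Da]] r0 ys.
(* From [c * |z| <= |y| + |t| * a * (|z| + 1) + C], once [|t| * a <= c / 2] and [|t| <= 1]. *)
pose B := 2 / c * (`|y| + C + a).
pose K := [set z : 'rV[R]_n | `|z| <= B] `&`
  [set z : 'rV[R]_n | forall x, x \in s -> r <= `|z - x|].
have Kc : compact K.
  apply: bounded_closed_compact.
    exists B; split; first exact: num_real.
    by move=> M BM z [zB _]; rewrite /= (le_trans zB)// ltW.
  apply: closedI.
    apply: (@closed_comp _ _ (fun z : 'rV[R]_n => `|z|) [set u | u <= B]).
      by move=> ? _; exact: norm_continuous.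
    exact: closed_le.
  rewrite (_ : mkset _ = \bigcap_(x in [set` s]) [set z | r <= `|z - x|])//.
  apply: closed_bigI => x _.
  apply: (@closed_comp _ _ (fun z : 'rV[R]_n => `|z - x|) [set u | r <= u]).
    move=> z _; apply: (@lipschitz_continuous _ _ _ _ 1) => u v.
    rewrite mul1r (le_trans (ler_dist_dist _ _))// opprB addrA subrK.
    exact: lexx.
  exact: closed_ge.
have [d d0 dK] : exists2 d : R, 0 < d & forall z, K z -> d <= `|G z - y|.
  have [K0|/eqP/set0P K0] := pselect (K = set0).
    by exists 1 => // z; rewrite K0.
  have hc : continuous (fun z => `|G z - y|).
    move=> z; apply: (@continuous_comp _ _ _ (fun z => G z - y)); last first.
      exact: norm_continuous.
    by apply: continuousB; [exact: Gc|exact: cst_continuous].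
  have [z zK zmin] := @EVT_min_rV _ _ (fun z => `|G z - y|) _ K0 Kc
    (continuous_subspaceT hc).
  rewrite inE in zK; exists `|G z - y|; last by move=> u Ku; apply: zmin; rewrite inE.
  rewrite normr_gt0 subr_eq0; apply/eqP => Gzy.
  have [_ /(_ z (ys _ Gzy))] := zK.
  by rewrite subrr normr0 leNgt r0.
apply/nbhs_norm_exP.
exists (Num.min (Num.min 1 (c / (2 * (a + 1)))) (d / (1 + a * (`|B| + 1)))).
  have h1 : 0 < 2 * (a + 1) by rewrite mulr_gt0// ltr_wpDl.
  have h2 : 0 < 1 + a * (`|B| + 1) by rewrite ltr_pwDl// mulr_ge0// addr_ge0.
  by rewrite !lt_min ltr01/= !divr_gt0.
move=> t; rewrite subr0 !lt_min => /andP[/andP[t1 t2] t3] z zE.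
have t0 : 0 <= `|t| := normr_ge0 t.
have z0 : 0 <= `|z| := normr_ge0 z.
have tD : `|t| * `|D z| <= `|t| * (a * (`|z| + 1)) by rewrite ler_wpM2l.
have t2' : `|t| * (2 * (a + 1)) < c by rewrite -ltr_pdivlMr// mulr_gt0// ltr_wpDl.
have t3' : `|t| * (1 + a * (`|B| + 1)) < d.
  by rewrite -ltr_pdivlMr// ltr_pwDl// mulr_ge0// addr_ge0.
have zB : `|z| <= B.
  have := GC z.
  have : `|G z| <= `|y| + `|t| * `|D z|.
    by rewrite -zE -normrZ -{1}[G z](addrK (t *: D z)) ler_normB.
  have h5 : `|t| * a * `|z| <= c / 2 * `|z| by rewrite ler_wpM2r//; nra.
  move=> h6 h7; rewrite /B mulrAC ler_pdivlMr//.
  have h8 : `|t| * a <= a by rewrite ler_piMl// ltW.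
  nra.
apply: contrapT => nos.
have Kz : K z.
  by split => // x xs; rewrite leNgt; apply/negP => zx; apply: nos; exists x.
have := dK z Kz; rewrite leNgt => /negP; apply.
rewrite -zE opprD addrA subrr add0r normrN normrZ.
have B0 : `|z| <= `|B| by rewrite (le_trans zB)// ler_norm.
have h : `|t| * (a * (`|z| + 1)) <= `|t| * (a * (`|B| + 1)).
  by rewrite ler_wpM2l// ler_wpM2l// lerD2r.
nra.
Qed.

(** Near a preimage [x] of [y] the perturbed map is affine with matrix [M x + t *: P x], still
    invertible with the same sign, so it has one solution there. These solutions are all of them,
    which gives a sign-preserving bijection of preimages. The affine form in the conclusion keeps
    [y] a regular value. *)
Lemma index_sum_stable (R : realType) (n : nat) (G D : 'rV[R]_n -> 'rV[R]_n)
    (y : 'rV[R]_n) :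
  continuous G -> coercive G -> linearly_bounded D ->
  finite_set (G @^-1` [set y]) ->
  (forall x, G x = y -> exists2 M, M \in unitmx & affine_near G x M) ->
  (forall x, G x = y -> exists P, affine_near D x P) ->
  \forall t \near (0 : R), let H := fun x => G x + t *: D x in
    [/\ forall x, H x = y -> exists2 M, M \in unitmx & affine_near H x M,
        finite_set (H @^-1` [set y]) &
        index_sum H y = index_sum G y].
Proof.
move=> Gc Gco Dl /finite_seqP[s sE] GM DP.
have ysE x : G x = y <-> x \in s by have := congr1 (fun A => A x) sE; rewrite /= => ->.
have [M M_] : {M : 'rV[R]_n -> 'M[R]_n &
    forall x, G x = y -> M x \in unitmx /\ affine_near G x (M x)}.
  apply: (@choice _ _ (fun x M => G x = y -> M \in unitmx /\ affine_near G x M)).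
  move=> x; have [/GM[M Mu MG]|Gx] := pselect (G x = y); first by exists M.
  by exists 0.
have [P P_] : {P : 'rV[R]_n -> 'M[R]_n & forall x, G x = y -> affine_near D x (P x)}.
  apply: (@choice _ _ (fun x P => G x = y -> affine_near D x P)).
  move=> x; have [/DP[P PD]|Gx] := pselect (G x = y); first by exists P.
  by exists 0.
have [r r0 rs] : exists2 r : R, 0 < r & forall x, x \in s -> forall z,
    `|z - x| < r -> G z = y + (z - x) *m M x /\ D z = D x + (z - x) *m P x.
  have : \forall r \near (0 : R)^'+, forall x, x \in s -> forall z,
      `|z - x| < r -> G z = y + (z - x) *m M x /\ D z = D x + (z - x) *m P x.
    apply: near_forall_mem => x /ysE Gx.
    have [r r0 rx] := (nbhs_norm_exP _ _).1 (filterI (M_ _ Gx).2 (P_ _ Gx)).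
    apply: filterS (nbhs_right_lt r0) => r' r'r z zr'.
    by rewrite -{1}Gx; apply: rx; exact: lt_trans r'r.
  move=> /(filterI (nbhs_right_gt (0 : R)))/filter_ex[r [r0 rs]].
  by exists r.
(* Solutions are kept within [r / 2], so that two preimages with the same perturbed solution are
   within [r] of each other, where [G] is injective. *)
have r20 : 0 < r / 2 by rewrite divr_gt0.
have r2r : r / 2 < r by rewrite ltr_pdivrMr// ltr_pMr// ltr1n.
have near0 : \forall t \near (0 : R), [/\
    (forall z, G z + t *: D z = y -> exists2 x, x \in s & `|z - x| < r / 2),
    (forall x, x \in s -> sgz (\det (M x + t *: P x)) = sgz (\det (M x))) &
    (forall x, x \in s -> forall u, u *m (M x + t *: P x) = - (t *: D x) ->
      `|u| < r / 2)].
  have ys : G @^-1` [set y] `<=` [set` s] by rewrite sE.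
  have h1 := zeros_near Gc Gco Dl r20 ys.
  have h2 : \forall t \near (0 : R), forall x, x \in s ->
      sgz (\det (M x + t *: P x)) = sgz (\det (M x)).
    by apply: (@near_forall_mem _ _ s (nbhs (0 : R))) => x /ysE /M_[Mu _]; exact: sgz_det_near.
  have h3 : \forall t \near (0 : R), forall x, x \in s ->
      forall u, u *m (M x + t *: P x) = - (t *: D x) -> `|u| < r / 2.
    by apply: (@near_forall_mem _ _ s (nbhs (0 : R))) => x /ysE /M_[Mu _]; exact: solution_near.
  by near=> t; split; near: t.
have [e e0 te] := (nbhs_norm_exP _ _).1 near0.
apply/nbhs_norm_exP; exists e; first exact: e0.
move=> t te0.
have [zt dt ut] := te t te0.
pose H x := G x + t *: D x.
change ([/\ forall x, H x = y -> exists2 M, M \in unitmx & affine_near H x M,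
  finite_set (H @^-1` [set y]) & index_sum H y = index_sum G y]).
pose Mt x := M x + t *: P x.
have Mtu x : x \in s -> Mt x \in unitmx.
  by move=> xs; rewrite unitmx_sgz dt// -unitmx_sgz; have [] := M_ x ((ysE x).2 xs).
have HE x z : x \in s -> `|z - x| < r -> H z = y + (z - x) *m Mt x + t *: D x.
  move=> xs zr; rewrite /H; have [-> ->] := rs x xs z zr.
  rewrite mulmxDr -scalemxAr scalerDr.
  by rewrite -!addrA; congr (_ + (_ + _)); rewrite addrC.
have HM x z : x \in s -> `|z - x| < r -> affine_near H z (Mt x).
  move=> xs zr; apply/nbhs_norm_exP; exists (r - `|z - x|); rewrite ?subr_gt0//.
  move=> w wr; rewrite !(HE x)//; last first.
    rewrite -[w](subrK z) -addrA (le_lt_trans (ler_normD _ _))//.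
    by rewrite -ltrBrDr.
  have -> : w - x = (z - x) + (w - z) by rewrite [RHS]addrC addrA subrK.
  by rewrite mulmxDl !addrA [in RHS]addrAC.
(* The perturbed preimage: the zero of the affine map [u |-> u *m Mt x + t *: D x], added to [x]. *)
pose h x := x - t *: D x *m invmx (Mt x).
have hx x : x \in s -> (h x - x) *m Mt x = - (t *: D x).
  by move=> xs; rewrite /h addrAC subrr add0r mulNmx mulmxKV ?Mtu.
have hr x : x \in s -> `|h x - x| < r / 2 by move=> xs; apply: (ut x xs); exact: hx.
have hbij : set_bij [set` s] (H @^-1` [set y]) h.
  split.
  - move=> x /= xs; rewrite (HE x)//; last exact: lt_trans (hr _ xs) r2r.
    by rewrite hx// subrK.
  - move=> x x'; rewrite !inE /= => xs x's hxx'.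
    have xx' : `|x' - x| < r.
      rewrite -[x'](subrK (h x)) -addrA (le_lt_trans (ler_normD _ _))//.
      by rewrite [r]splitr ltrD ?hr// distrC hxx' hr.
    have [] := rs x xs x' xx'; rewrite (ysE x').2// => /eqP.
    rewrite -subr_eq0 opprD addrA subrr sub0r oppr_eq0 => /eqP xM0 _.
    have [Mu _] := M_ x ((ysE x).2 xs).
    apply/esym/eqP; rewrite -subr_eq0 -[_ - _](mulmxK Mu) xM0 mul0mx.
    exact: eqxx.
  - move=> z /= Hz; have [x xs zx] := zt z Hz; exists x => //.
    have : (h x - x) *m Mt x = (z - x) *m Mt x.
      rewrite hx//; apply/esym/eqP; rewrite -subr_eq0 opprK; apply/eqP.
      apply: (addrI y); rewrite addr0 addrA -HE//.
      exact: lt_trans zx r2r.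
    move=> /(congr1 (mulmx^~ (invmx (Mt x)))).
    by rewrite /= !mulmxK ?Mtu// => /addIr.
split.
- move=> z Hz; have [_ _ /(_ z Hz)[x xs hxz]] := hbij.
  exists (Mt x); first exact: Mtu.
  by apply: HM => //; rewrite -hxz (lt_trans (hr _ xs)).
- have <- : h @` [set` s] = H @^-1` [set y].
    by case: hbij => hf _ hs; apply/seteqP; split=> [_ [x xs <-]|//]; exact: hf.
  by apply: finite_image; apply/finite_seqP; exists s.
- rewrite /index_sum sE.
  transitivity (\sum_(x \in [set` s]) sgz (\det ('J H (h x)))).
    exact: (reindex_fsbig h [set` s] (H @^-1` [set y])
      (fun x => sgz (\det ('J H x))) hbij).
  apply: eq_fsbigr => x; rewrite inE => /= xs.
  have [_ JH] := affine_near_jacobian (HM _ _ xs (lt_trans (hr _ xs) r2r)).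
  have [_ /affine_near_jacobian[_ JG]] := M_ x ((ysE x).2 xs).
  rewrite JH JG.
  exact: dt.
Unshelve. all: by end_near. Qed.

Lemma affine_regular_value (R : realType) (n : nat)
    (G : 'rV[R]_n -> 'rV[R]_n) (y : 'rV[R]_n) :
  (forall x, G x = y -> exists2 M, M \in unitmx & affine_near G x M) ->
  regular_value G y.
Proof.
move=> GM x /GM[M Mu /affine_near_jacobian[dG JG]].
by split; rewrite ?JG.
Qed.

Lemma regular_preimage (R : realType) (n k : nat) (G : 'rV[R]_n -> 'rV[R]_n)
    (A : 'I_k -> 'M[R]_n) (b : 'I_k -> 'rV[R]_n) (y : 'rV[R]_n) :
  composed_of G A b -> regular_value G y ->
  finite_set (G @^-1` [set y]) /\
  forall x, G x = y -> exists2 M, M \in unitmx & affine_near G x M.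
Proof.
move=> GAb yreg; split; last first.
  move=> x /yreg[dG Ju]; exists ('J G x) => //.
  exact: composed_linear_near GAb dG.
(* Each preimage solves an invertible piece. For a singular [A i] the junk value of [invmx] merely
   adds a point to the finite superset. *)
apply: (@sub_finite_set _ _ ((fun i => (y - b i) *m invmx (A i)) @` setT)).
  move=> x /= Gx; have [dG Ju] := yreg x Gx.
  have [i GxA JA] := composed_jacobian GAb dG; exists i => //.
  by rewrite -Gx GxA addrK mulmxK// -JA.
exact: finite_image.
Qed.

Lemma composed_linearly_bounded (R : realType) (n m k : nat)
    (G : 'rV[R]_n -> 'rV[R]_m) (A : 'I_k -> 'M[R]_(n, m))
    (b : 'I_k -> 'rV[R]_m) :
  composed_of G A b -> linearly_bounded G.
Proof.
move=> [_ GAb].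
have [C CP] : {C : 'I_k -> R & forall i, 0 < C i /\
    forall x : 'rV[R]_n, `|x *m A i| <= C i * `|x|}.
  apply: (@choice _ _ (fun i C => 0 < C /\
    forall x : 'rV[R]_n, `|x *m A i| <= C * `|x|)) => i.
  by have [C C0 CP] := mulmx_bounded (A i); exists C.
have Cs0 i : 0 <= C i + `|b i| by rewrite addr_ge0// ltW; have [] := CP i.
exists (\sum_i (C i + `|b i|)); split; first by rewrite sumr_ge0.
move=> x; have [i ->] := GAb x.
apply: (@le_trans _ _ ((C i + `|b i|) * (`|x| + 1))); last first.
  by rewrite ler_wpM2r ?addr_ge0// (bigD1 i)//= lerDl sumr_ge0.
have [Ci0 /(_ x) xA] := CP i.
apply: le_trans (ler_normD _ _) _.
have b0 : 0 <= `|b i| := normr_ge0 _; have x0 : 0 <= `|x| := normr_ge0 _.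
nra.
Qed.

Lemma row_subE (R : zmodType) (n : nat) (v w : 'rV[R]_n) c :
  (v - w) ord0 c = v ord0 c - w ord0 c.
Proof. by rewrite !mxE. Qed.

(** * Crossing a wall *)

(** The matrix determinant lemma: multiplication by unitriangular block matrices exchanges the two
    block triangular matrices whose determinants are the two sides. *)
Lemma det_1D_rank1 (R : comRingType) (n : nat) (u : 'cV[R]_n) (c : 'rV[R]_n) :
  \det (1%:M + u *m c) = 1 + (c *m u) ord0 ord0.
Proof.
pose P : 'M[R]_(n + 1) := block_mx 1%:M 0 c 1%:M.
pose Q : 'M[R]_(n + 1) := block_mx 1%:M 0 (- c) 1%:M.
pose T : 'M[R]_(n + 1) := block_mx (1%:M + u *m c) u 0 1%:M.
have PTQ : P *m T *m Q = block_mx 1%:M u 0 (1%:M + c *m u).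
  rewrite /P /T /Q !mulmx_block !mul1mx !mul0mx !mulmx1 !mulmx0 !addr0.
  congr block_mx.
  - by rewrite mulmxN addrK.
  - by rewrite add0r.
  - by rewrite mulmxDr mulmx1 mulmxN mulmxDl mul1mx mulmxA [X in _ - X]addrC subrr.
  - by rewrite add0r addrC.
have : \det (P *m T *m Q) = \det (1%:M + c *m u).
  by rewrite PTQ det_ublock det1 mul1r.
rewrite !det_mulmx /P /T /Q !det_lblock det_ublock !det1 !mulr1 mul1r => ->.
by rewrite det_mx11 !mxE.
Qed.

Definition wall (R : realType) (n : nat) (u : 'cV[R]_n) (e : R)
    (x : 'rV[R]_n) : R :=
  (x *m u) ord0 ord0 + e.

Lemma wall_affine (R : realType) (n : nat) (u : 'cV[R]_n) (e : R) :
  affine_fun (wall u e).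
Proof.
move=> x y t; rewrite /wall mulmxDl -scalemxAl mulmxBl.
by move: (x *m u) (y *m u) => v w; rewrite !mxE; ring.
Qed.

Lemma wall_shift (R : realType) (n : nat) (u : 'cV[R]_n) (e : R)
    (x h : 'rV[R]_n) :
  wall u e (x + h) = wall u e x + (h *m u) ord0 ord0.
Proof. by rewrite /wall mulmxDl mxE addrAC. Qed.

Lemma wall_continuous (R : realType) (n : nat) (u : 'cV[R]_n) (e : R) :
  continuous (wall u e).
Proof.
have [C _ uC] := mulmx_bounded u.
apply: (@lipschitz_continuous _ _ _ _ C) => x y.
rewrite /wall opprD addrACA subrr addr0.
apply: le_trans (uC (x - y)); rewrite mulmxBl.
by have := ler_coord_norm (x *m u - y *m u) ord0; rewrite !mxE.
Qed.

Lemma affine_pos_near (R : realType) (a c : R) :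
  0 < a -> \forall t \near (0 : R), 0 < a + t * c.
Proof.
move=> a0; apply/nbhs_norm_exP; exists (a / (1 + `|c|)).
  by rewrite divr_gt0// ltr_pwDl.
have c0 : 0 < 1 + `|c| by rewrite ltr_pwDl.
move=> t; rewrite subr0 ltr_pdivlMr// => ta.
have tc : `|t * c| <= `|t| * (1 + `|c|).
  by rewrite [`|t * c|]normrM ler_wpM2l// lerDr.
have := ler_norm (- (t * c)); rewrite normrN => tc'.
lra.
Qed.

Section Cells.
Context (R : realType) (n k q : nat).
Context (G : 'rV[R]_n -> 'rV[R]_n) (A : 'I_k -> 'M[R]_n) (b : 'I_k -> 'rV[R]_n).
Context (u : 'I_q -> 'cV[R]_n) (e : 'I_q -> R).
Context (GAb : composed_of G A b).

Local Notation l j := (wall (u j) (e j)).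
Local Notation piece i x := (x *m A i + b i).

(** Every coincidence of one coordinate of two pieces is either an identity or confined to the
    walls. *)
Context (wall_sep : forall i i' c x, (forall j, l j x != 0) ->
  (piece i x) ord0 c = (piece i' x) ord0 c ->
  forall z, (piece i z) ord0 c = (piece i' z) ord0 c).

(** [s j] true selects the negative side of wall [j]. *)
Definition side (s : {ffun 'I_q -> bool}) j x : R := (-1) ^+ s j * l j x.
Definition in_cell s x := forall j, 0 < side s j x.
Definition in_closed_cell s x := forall j, 0 <= side s j x.

Lemma side_affine s j : affine_fun (side s j).
Proof. by move=> x y t; rewrite /side wall_affine; ring. Qed.

Lemma cell_segment s x p t : in_closed_cell s x -> in_cell s p -> 0 < t <= 1 ->
  in_cell s (x + t *: (p - x)).
Proof.
move=> sx sp /andP[t0 t1] j; rewrite side_affine.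
by have := sx j; have := sp j; nra.
Qed.

Lemma in_cell_closed s x : in_cell s x -> in_closed_cell s x.
Proof. by move=> sx j; exact: ltW. Qed.

Lemma in_cell_generic s x : in_cell s x -> forall j, l j x != 0.
Proof.
move=> sx j; apply/eqP => lj; have := sx j.
by rewrite /side lj mulr0 ltxx.
Qed.

Lemma piece_segment i x p t :
  piece i (x + t *: (p - x)) = piece i x + t *: (piece i p - piece i x).
Proof.
rewrite mulmxDl -scalemxAl mulmxBl; move: (x *m A i) (p *m A i) => v w.
by apply/rowP => j; rewrite !mxE; ring.
Qed.

(** Along the segment from [x] to [p], each coordinate of [G - piece i] is always one of the affine
    differences [d i']. Inside a cell such a difference is identically zero or never zero, so on the
    segment it is bounded away from 0 by its endpoint values. *)
Lemma cell_piece s x p i :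
  in_cell s x -> in_cell s p -> G x = piece i x -> G p = piece i p.
Proof.
move=> sx sp Gx; apply/eqP; rewrite -subr_eq0; apply/eqP/rowP => c.
rewrite [RHS]mxE.
pose d i' z := (piece i' z - piece i z) ord0 c.
have [g g0 gd] := finite_gap (fun ib : 'I_k * bool => d ib.1 (if ib.2 then p else x)).
pose y t := x + t *: (p - x).
have y1 : y 1 = p by rewrite /y scale1r addrC subrK.
have y0 : y 0 = x by rewrite /y scale0r addr0.
pose f t := (G (y t) - piece i (y t)) ord0 c.
have -> : (G p - piece i p) ord0 c = f 1 by rewrite /f y1.
have yc : continuous y.
  move=> t; apply: cvgD; first exact: cvg_cst.
  by apply: cvgZl; exact: cvg_id.
apply: (continuous_gap_eq0 _ _ g0).
- apply: continuous_subspaceT.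
  pose F z := G z - piece i z.
  have Fc z : {for z, continuous F}.
    apply: continuousB; first exact: GAb.1.
    by apply: continuousD; [exact: mulmx_continuous|exact: cst_continuous].
  move=> t; apply: (@continuous_comp _ _ _ (F \o y) (fun v : 'rV_n => v ord0 c)).
    exact: (continuous_comp (yc _) (Fc _)).
  exact: coord_continuous.
- by rewrite /f y0 Gx subrr mxE.
- move=> t /andP[t0 t1].
  have yt : in_cell s (y t).
    have [->|tn0] := eqVneq t 0; first by rewrite y0.
    by apply: cell_segment => //; [exact: in_cell_closed|rewrite t1 andbT lt_neqAle eq_sym tn0 t0].
  have [i' Gy] := GAb.2 (y t); rewrite /f Gy -/(d i' (y t)).
  have d0 z : d i' z = 0 -> (forall j, l j z != 0) -> d i' (y t) = 0.
    rewrite /d !row_subE => /eqP; rewrite subr_eq0 => /eqP dz lz.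
    apply/eqP; rewrite subr_eq0; apply/eqP.
    exact: wall_sep lz dz _.
  have dE r : d i' (y r) = d i' x + r * (d i' p - d i' x).
    rewrite /d /y !piece_segment; move: (piece i p) (piece i x) (piece i' x) => v1 v2 v3.
    by rewrite !mxE; ring.
  have [dx|gx] := gd (i', false); first by left; apply: d0 dx (in_cell_generic sx).
  have [dp|gp] := gd (i', true); first by left; apply: d0 dp (in_cell_generic sp).
  rewrite /= in gx gp.
  (* With equal signs at the ends, the difference keeps size [g] in between. With opposite signs it
     vanishes at the parameter [r] inside the cell, hence identically. *)
  have [dxp|dxp] := lerP (d i' x * d i' p) 0; last first.
    right; rewrite dE; move: gx gp dxp.
    by case: (ger0P (d i' x)); case: (ger0P (d i' p)) => ? ? ? ? ?;
       case: ger0P => ?; nra.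
  left.
  have dd : d i' x - d i' p != 0.
    apply/eqP => dd0; have dd1 : d i' p = d i' x by lra.
    move: dxp gx; rewrite dd1 -expr2 => h1 h2.
    have : 0 < `|d i' x| ^+ 2 by rewrite exprn_gt0// (lt_le_trans g0).
    by rewrite real_normK ?num_real// ltNge h1.
  pose r := d i' x / (d i' x - d i' p).
  have r01 : 0 <= r <= 1.
    have r2 : r * (d i' x - d i' p) = d i' x by rewrite /r divfK.
    have h : 0 < (d i' x - d i' p) ^+ 2 by rewrite exprn_even_gt0.
    apply/andP; split.
      rewrite -(pmulr_lge0 _ h) expr2 mulrA r2; nra.
    rewrite -subr_ge0 -(pmulr_lge0 _ h) expr2 mulrA mulrBl r2; nra.
  apply: (d0 (y r)).
    by rewrite dE /r; field.
  apply: (@in_cell_generic s); have [->|rn0] := eqVneq r 0; first by rewrite y0.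
  apply: cell_segment => //; first exact: in_cell_closed.
  by move/andP: r01 => [r0 ->]; rewrite andbT lt_neqAle eq_sym rn0 r0.
Qed.

(** The segment from [x] to the interior point [p] lies in the open cell except possibly at [x];
    continuity extends the equality to [x]. *)
Lemma closed_cell_piece s x p i : in_cell s p -> G p = piece i p ->
  in_closed_cell s x -> G x = piece i x.
Proof.
move=> sp Gp sx; apply/eqP/negPn/negP => Gx.
have hc : {for x, continuous (fun z => `|G z - piece i z|)}.
  apply: continuous_comp; last exact: norm_continuous.
  apply: continuousB; first exact: GAb.1.
  by apply: continuousD; [exact: mulmx_continuous|exact: cst_continuous].
have := @cvgr_gt _ _ _ _ _ _ hc 0; rewrite normr_gt0 subr_eq0 => /(_ _ Gx).
move=> /nbhs_norm_exP[r r0 rG].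
pose t := Num.min 1 (r / 2 / (1 + `|p - x|)).
have px : 0 < 1 + `|p - x| by rewrite ltr_pwDl.
have t0 : 0 < t by rewrite lt_min ltr01 !divr_gt0.
have t1 : t <= 1 by rewrite ge_min lexx.
have tr : t * (1 + `|p - x|) <= r / 2 by rewrite -ler_pdivlMr// ge_min lexx orbT.
have st : in_cell s (x + t *: (p - x)) by apply: cell_segment; rewrite ?t0.
have := rG (x + t *: (p - x)); rewrite (cell_piece sp st Gp) subrr normr0 ltxx.
move=> h; apply/notF/h; rewrite addrAC subrr add0r normrZ gtr0_norm//.
by have : 0 <= `|p - x| := normr_ge0 _; nra.
Qed.

End Cells.

(** Connectedness of the line, obtained from the vanishing derivative. *)
Lemma constant_of_locally (R : realType) (f : R -> R) (x y : R) :
  (forall s, \forall t \near s, f t = f s) -> f x = f y.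
Proof.
move=> fl; apply: is_derive_0_is_cst => s.
have fc : \forall t \near s, cst (f s) t = f t.
  by have := fl s; apply: filterS => t ->.
exact: near_eq_is_derive fc (is_derive_cst (f s) s 1).
Qed.

(* The weight 1/2 of a wall keeps [cell_sum] constant also at the parameters
   where a preimage lies on a wall. *)
Definition half_sign (R : realType) (x : R) : R := (1 + Num.sg x) / 2.

Section CellSum.
Context (R : realType) (n k q : nat).
Context (G : 'rV[R]_n -> 'rV[R]_n) (A : 'I_k -> 'M[R]_n) (b : 'I_k -> 'rV[R]_n).
Context (u : 'I_q -> 'cV[R]_n) (e : 'I_q -> R).
Context (GAb : composed_of G A b) (A_unit : forall i, A i \in unitmx).

Local Notation l j := (wall (u j) (e j)).
Local Notation piece i x := (x *m A i + b i).

Context (wall_sep : forall i i' c x, (forall j, l j x != 0) ->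
  (piece i x) ord0 c = (piece i' x) ord0 c ->
  forall z, (piece i z) ord0 c = (piece i' z) ord0 c).

(** The value at an empty cell is arbitrary, which is why [cell_sum] ranges over nonempty cells. *)
Context (idx : {ffun 'I_q -> bool} -> 'I_k).
Context (idxP : forall s x, in_cell u e s x -> G x = piece (idx s) x).

Local Notation cell s := (in_cell u e s).
Local Notation closed_cell s := (in_closed_cell u e s).

Definition solution i y := (y - b i) *m invmx (A i).

Lemma piece_solution i y : piece i (solution i y) = y.
Proof. by rewrite /solution mulmxKV// subrK. Qed.

Lemma solution_piece i x : solution i (piece i x) = x.
Proof. by rewrite /solution addrK mulmxK. Qed.

Lemma solution_shift i y h :
  solution i (y + h) = solution i y + h *m invmx (A i).
Proof. by rewrite /solution addrAC mulmxDl. Qed.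

Definition nonempty_cell s := `[< exists p, cell s p >].

(** The only candidate for a preimage of [y] in the cell is [solution (idx s) y]. The product is 1
    if it lies in the open cell and 0 if it is strictly beyond some wall. *)
Definition cell_weight (s : {ffun 'I_q -> bool}) y : R :=
  Num.sg (\det (A (idx s))) *
  \prod_j half_sign (side u e s j (solution (idx s) y)).

Definition cell_sum y := \sum_(s | nonempty_cell s) cell_weight s y.

Lemma closed_cell_idx s x : nonempty_cell s -> closed_cell s x ->
  G x = piece (idx s) x.
Proof.
move=> /asboolP[p sp] sx.
exact: (closed_cell_piece GAb wall_sep sp (idxP sp) sx).
Qed.

Definition sign_vector (x : 'rV[R]_n) : {ffun 'I_q -> bool} :=
  [ffun j => l j x < 0].

Lemma sign_vectorP x : (forall j, l j x != 0) -> cell (sign_vector x) x.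
Proof.
move=> lx j; rewrite /side ffunE; have := lx j; rewrite neq_lt => /orP[lj|lj].
  by rewrite lj expr1 mulN1r oppr_gt0.
by rewrite (lt_gtF lj) expr0 mul1r.
Qed.

Lemma cell_inj s s' x : cell s x -> cell s' x -> s = s'.
Proof.
move=> sx s'x; apply/ffunP => j; have := sx j; have := s'x j.
by rewrite /side; case: (s j); case: (s' j); rewrite ?expr0 ?expr1 ?mul1r ?mulN1r//;
   rewrite ?oppr_gt0 => h1 h2; have := lt_trans h1 h2; rewrite ltxx.
Qed.

Lemma cell_near s x : cell s x -> \forall z \near x, cell s z.
Proof.
move=> sx; apply: (@filter_forall _ _ _ (nbhs x)) => j.
have sc : {for x, continuous (side u e s j)}.
  by apply: continuousM; [exact: cst_continuous|exact: wall_continuous].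
have := @cvgr_gt _ _ _ _ _ _ sc 0 => /(_ _ (sx j)).
by apply.
Qed.

Lemma cell_affine_near s x : cell s x -> affine_near G x (A (idx s)).
Proof.
move=> sx; apply: filterS (cell_near sx) => z sz.
rewrite (idxP sz) (idxP sx) mulmxBl; move: (z *m _) (x *m _) => v w.
by apply/rowP => j; rewrite !mxE; ring.
Qed.

(** No candidate lies on a wall, so all weights are 0 or a full sign, and the nonzero ones
    correspond to the preimages, each of which lies in exactly one cell. *)
Lemma index_cell_sum y : (forall i j, l j (solution i y) != 0) ->
  (index_sum G y)%:~R = cell_sum y.
Proof.
move=> ygen.
pose P := [pred s | `[< cell s (solution (idx s) y) >]].
have hbij : set_bij [set` enum P] (G @^-1` [set y]) (fun s => solution (idx s) y).
  split.
  - move=> s; rewrite /= mem_enum => /asboolP sx.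
    by rewrite (idxP sx) piece_solution.
  - move=> s s'; rewrite !inE /= !mem_enum => /asboolP sx /asboolP s'x ss'.
    by apply: (cell_inj sx); rewrite ss'.
  - move=> x /= Gx; have [i Gxi] := GAb.2 x.
    have xi : x = solution i y by rewrite -Gx Gxi solution_piece.
    have sx : cell (sign_vector x) x by apply: sign_vectorP => j; rewrite xi.
    have xs : solution (idx (sign_vector x)) y = x.
      by rewrite -Gx (idxP sx) solution_piece.
    exists (sign_vector x) => //; rewrite mem_enum; apply/asboolP.
    by rewrite xs.
have -> : index_sum G y = \sum_(s in P) sgz (\det (A (idx s))).
  rewrite -big_enum fsbig_seq ?enum_uniq//.
  transitivity (\sum_(s \in [set` enum P]) sgz (\det ('J G (solution (idx s) y)))).
    exact: (reindex_fsbig (fun s => solution (idx s) y) [set` enum P]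
      (G @^-1` [set y]) (fun x => sgz (\det ('J G x))) hbij).
  apply: eq_fsbigr => s; rewrite inE /= mem_enum => /asboolP sx.
  by have [_ ->] := affine_near_jacobian (cell_affine_near sx).
rewrite rmorph_sum/= /cell_sum big_mkcond [RHS]big_mkcond/=.
apply: eq_bigr => s _; rewrite -sgrEz /cell_weight.
have [sx|sx] := boolP (s \in P).
  have {}sx : cell s (solution (idx s) y) by apply/asboolP.
  rewrite ifT; last by apply/asboolP; exists (solution (idx s) y).
  rewrite big1 ?mulr1// => j _.
  by rewrite /half_sign gtr0_sg// -(natrD _ 1 1) divff.
case: ifP => // _; have [j sj] : exists j, side u e s j (solution (idx s) y) < 0.
  apply: contrapT => no; case/negP: sx; apply/asboolP => j.
  rewrite lt_neqAle eq_sym; apply/andP; split.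
    by rewrite mulf_neq0 ?ygen// signr_eq0.
  by rewrite leNgt; apply/negP => sj; apply: no; exists j.
have h0 : half_sign (side u e s j (solution (idx s) y)) = 0.
  by rewrite /half_sign (ltr0_sg sj) addrN mul0r.
by rewrite (bigD1 j)//= h0 mul0r mulr0.
Qed.

End CellSum.

Section Crossing.
Context (R : realType) (n k q : nat).
Context (G : 'rV[R]_n -> 'rV[R]_n) (A : 'I_k -> 'M[R]_n) (b : 'I_k -> 'rV[R]_n).
Context (u : 'I_q -> 'cV[R]_n) (e : 'I_q -> R).
Context (GAb : composed_of G A b) (A_unit : forall i, A i \in unitmx).

Local Notation l j := (wall (u j) (e j)).
Local Notation piece i x := (x *m A i + b i).

Context (wall_sep : forall i i' c x, (forall j, l j x != 0) ->
  (piece i x) ord0 c = (piece i' x) ord0 c ->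
  forall z, (piece i z) ord0 c = (piece i' z) ord0 c).

Context (idx : {ffun 'I_q -> bool} -> 'I_k).
Context (idxP : forall s x, in_cell u e s x -> G x = piece (idx s) x).

Local Notation cell s := (in_cell u e s).
Local Notation closed_cell s := (in_closed_cell u e s).
Local Notation side := (side u e).
Local Notation nonempty_cell := (nonempty_cell u e).
Local Notation solution := (solution A b).

Definition flip (j : 'I_q) (s : {ffun 'I_q -> bool}) : {ffun 'I_q -> bool} :=
  [ffun i => if i == j then ~~ s i else s i].

Lemma flipK j : involutive (flip j).
Proof.
by move=> s; apply/ffunP => i; rewrite !ffunE; case: eqP => // _; rewrite negbK.
Qed.

Lemma side_flip j s x : side (flip j s) j x = - side s j x.
Proof. by rewrite /side ffunE eqxx signrN mulNr. Qed.

Lemma side_flip_neq j i s x : i != j -> side (flip j s) i x = side s i x.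
Proof. by move=> ij; rewrite /side ffunE (negPf ij). Qed.

Lemma side_eq0 s j x : (side s j x == 0) = (l j x == 0).
Proof. by rewrite /side mulf_eq0 signr_eq0. Qed.

Lemma flip_closed_cell j s x : l j x = 0 -> closed_cell s x ->
  closed_cell (flip j s) x.
Proof.
move=> lj sx i; have [->|ij] := eqVneq i j; last by rewrite side_flip_neq.
by rewrite side_flip /side lj mulr0 oppr0.
Qed.

(** Prolonging the segment from [p] to [x] slightly beyond [x] crosses wall [j] and no other wall,
    since [x] is off the others. *)
Lemma flip_nonempty j s x : l j x = 0 -> (forall i, i != j -> l i x != 0) ->
  closed_cell s x -> nonempty_cell s -> nonempty_cell (flip j s).
Proof.
move=> lj li sx /asboolP[p sp].
have [r r0 rP] : exists2 r : R, 0 < r & forall t, `|t - 0| < r ->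
    forall i, i != j -> 0 < side s i x + t * (side s i p - side s i x).
  apply/nbhs_norm_exP; apply: (@filter_forall _ _ _ (nbhs (0 : R))) => i.
  have [->|ij] := eqVneq i j; first exact: nearW.
  have si : 0 < side s i x by rewrite lt_neqAle eq_sym side_eq0 li// sx.
  by apply: filterS (affine_pos_near (side s i p - side s i x) si) => t.
apply/asboolP; exists (x + (- (r / 2)) *: (p - x)) => i.
have [->|ij] := eqVneq i j.
  rewrite side_flip side_affine; have := sp j.
  have -> : side s j x = 0 by apply/eqP; rewrite side_eq0 lj.
  by rewrite subr0 add0r mulNr opprK => ?; rewrite mulr_gt0// divr_gt0.
rewrite side_flip_neq// side_affine; apply: rP => //.
by rewrite subr0 normrN gtr0_norm ?divr_gt0// ltr_pdivrMr// ltr_pMr// ltr1n.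
Qed.

(** By continuity the two pieces agree on the common facet near [x]. Every direction in the kernel
    of [u j] can be realized in that facet, so the difference of the matrices vanishes on this
    kernel. *)
Lemma flip_rank1 j s x : l j x = 0 -> (forall i, i != j -> l i x != 0) ->
  closed_cell s x -> nonempty_cell s ->
  exists c, A (idx (flip j s)) = A (idx s) + u j *m c.
Proof.
move=> lj li sx sne.
have fsne := flip_nonempty lj li sx sne.
have agree z : closed_cell s z -> l j z = 0 ->
    piece (idx s) z = piece (idx (flip j s)) z.
  move=> sz ljz; rewrite -(closed_cell_idx GAb wall_sep idxP sne sz).
  exact: (closed_cell_idx GAb wall_sep idxP fsne (flip_closed_cell ljz sz)).
have ker (h : 'rV_n) : (h *m u j) ord0 ord0 = 0 ->
    h *m A (idx s) = h *m A (idx (flip j s)).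
  move=> hu.
  have [r r0 rP] : exists2 r : R, 0 < r & forall t, `|t - 0| < r ->
      forall i, i != j -> 0 < side s i x + t * (side s i (x + h) - side s i x).
    apply/nbhs_norm_exP; apply: (@filter_forall _ _ _ (nbhs (0 : R))) => i.
    have [->|ij] := eqVneq i j; first exact: nearW.
    have si : 0 < side s i x by rewrite lt_neqAle eq_sym side_eq0 li// sx.
    by apply: filterS (affine_pos_near (side s i (x + h) - side s i x) si) => t.
  pose t := r / 2.
  have t0 : 0 < t by rewrite divr_gt0.
  have ljt : l j (x + t *: h) = 0.
    by rewrite wall_shift lj -scalemxAl mxE hu mulr0 addr0.
  have st : closed_cell s (x + t *: h).
    move=> i; have [->|ij] := eqVneq i j; first by rewrite /side ljt mulr0.
    have := side_affine u e s i x (x + h) t; rewrite [x + h]addrC addrK => ->.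
    rewrite [h + x]addrC ltW//; apply: rP => //.
    by rewrite subr0 gtr0_norm// ltr_pdivrMr// ltr_pMr// ltr1n.
  have := agree _ st ljt; rewrite !mulmxDl !(addrAC _ (_ *: _ *m _)) (agree _ sx lj).
  move=> /addrI; rewrite -!scalemxAl => /(congr1 (fun v => t^-1 *: v)).
  by rewrite !scalerA mulVf ?gt_eqF// !scale1r.
have [p sp] := asboolP _ sne.
have pu : (p - x) *m u j != 0.
  apply/eqP => pu0; have := sp j.
  have -> : p = x + (p - x) by rewrite addrC subrK.
  by rewrite /side wall_shift lj pu0 mxE addr0 mulr0 ltxx.
pose v := ((p - x) *m u j) ord0 ord0.
have v0 : v != 0.
  apply: contraNneq pu => v0; apply/eqP/matrixP => i i'.
  by rewrite !ord1 [RHS]mxE; exact: v0.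
pose D := A (idx (flip j s)) - A (idx s).
(* The direction [p - x] is transverse to the wall, and [c] is forced by the value of [D] on it:
   every vector is a multiple of [p - x] plus a kernel vector. *)
exists (v^-1 *: ((p - x) *m D)).
apply/eqP; rewrite addrC -subr_eq -/D; apply/eqP/row_matrixP => i.
rewrite !rowE mulmxA.
set d := delta_mx 0 i; pose a := (d *m u j) ord0 ord0.
have -> : d *m u j = a%:M by rewrite [LHS]mx11_scalar.
rewrite mul_scalar_mx scalerA.
have : (d - (a / v) *: (p - x)) *m D = 0.
  rewrite mulmxBr; apply/eqP; rewrite subr_eq0 eq_sym; apply/eqP/ker.
  by rewrite mulmxBl -scalemxAl row_subE [X in _ - X]mxE -/v -/a divfK// subrr.
by rewrite mulmxBl -scalemxAl => /eqP; rewrite subr_eq0 => /eqP.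
Qed.

(** When the value moves by [d], the half weights of the two adjacent cells change by amounts
    proportional to these two terms; their cancellation is the invariance across the wall. *)
Lemma crossing_signs j s x d : l j x = 0 -> (forall i, i != j -> l i x != 0) ->
  closed_cell s x -> nonempty_cell s ->
  Num.sg (\det (A (idx s))) * Num.sg (side s j (x + d *m invmx (A (idx s)))) +
  Num.sg (\det (A (idx (flip j s)))) *
    Num.sg (side (flip j s) j (x + d *m invmx (A (idx (flip j s))))) = 0.
Proof.
move=> lj li sx sne; have [c AE] := flip_rank1 lj li sx sne.
set a := A (idx s) in AE *; set a' := A (idx (flip j s)) in AE *.
have au : a \in unitmx by exact: A_unit.
have au' : a' \in unitmx by exact: A_unit.
pose kappa := 1 + (c *m invmx a *m u j) ord0 ord0.
have detE : \det a' = \det a * kappa.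
  rewrite /kappa -mulmxA -det_1D_rank1 -det_mulmx mulmxDr mulmx1 mulmxA.
  by rewrite mulmxA mulmxV// mul1mx AE.
(* [kappa] is both the quotient of the two determinants and the quotient of the
   two values of the wall functional. *)
set h := d *m invmx a; set h' := d *m invmx a'.
have hE : h = h' + (h' *m u j) *m (c *m invmx a).
  rewrite /h -[d in LHS](mulmxKV au') -/h' AE mulmxDr mulmxDl mulmxK//.
  by rewrite !mulmxA.
have huE : (h *m u j) ord0 ord0 = kappa * (h' *m u j) ord0 ord0.
  rewrite {1}hE mulmxDl mxE -mulmxA /kappa; set v := h' *m u j.
  by rewrite mulrDl mul1r; congr (_ + _); rewrite mxE big_ord1 mulrC.
rewrite side_flip /side !wall_shift lj !add0r huE detE !(sgrN, sgrM).
have k0 : kappa != 0.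
  move: au'; rewrite unitmxE unitfE detE mulf_eq0 negb_or => /andP[_ ->//].
by case: (sgrP kappa) k0 => //= _ _; ring.
Qed.

End Crossing.

Lemma half_sign_gt0 (R : realType) (x : R) : 0 < x -> half_sign x = 1.
Proof. by move=> x0; rewrite /half_sign gtr0_sg// -(natrD _ 1 1) divff. Qed.

Lemma half_sign_lt0 (R : realType) (x : R) : x < 0 -> half_sign x = 0.
Proof. by move=> x0; rewrite /half_sign (ltr0_sg x0) addrN mul0r. Qed.

Lemma half_sign_sub0 (R : realType) (x : R) :
  half_sign x - half_sign 0 = Num.sg x / 2.
Proof. by rewrite /half_sign sgr0; field. Qed.

Section Line.
Context (R : realType) (n k q : nat).
Context (G : 'rV[R]_n -> 'rV[R]_n) (A : 'I_k -> 'M[R]_n) (b : 'I_k -> 'rV[R]_n).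
Context (u : 'I_q -> 'cV[R]_n) (e : 'I_q -> R).
Context (GAb : composed_of G A b) (A_unit : forall i, A i \in unitmx).

Local Notation l j := (wall (u j) (e j)).
Local Notation piece i x := (x *m A i + b i).

Context (wall_sep : forall i i' c x, (forall j, l j x != 0) ->
  (piece i x) ord0 c = (piece i' x) ord0 c ->
  forall z, (piece i z) ord0 c = (piece i' z) ord0 c).

Context (idx : {ffun 'I_q -> bool} -> 'I_k).
Context (idxP : forall s x, in_cell u e s x -> G x = piece (idx s) x).

Local Notation cell s := (in_cell u e s).
Local Notation closed_cell s := (in_closed_cell u e s).
Local Notation side := (side u e).
Local Notation nonempty_cell := (nonempty_cell u e).
Local Notation solution := (solution A b).
Local Notation cell_weight := (cell_weight A b u e idx).
Local Notation cell_sum := (cell_sum A b u e idx).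

Context (y w : 'rV[R]_n).
Context (transverse : forall i j j' t, j != j' ->
  l j (solution i (y + t *: w)) = 0 -> l j' (solution i (y + t *: w)) != 0).

Lemma sides_near t0 : \forall t \near t0, forall s j,
  let v t := side s j (solution (idx s) (y + t *: w)) in
  (0 < v t0 -> 0 < v t) /\ (v t0 < 0 -> v t < 0).
Proof.
have : \forall r \near (0 : R), forall s j,
  let v t := side s j (solution (idx s) (y + t *: w)) in
  (0 < v t0 -> 0 < v (t0 + r)) /\ (v t0 < 0 -> v (t0 + r) < 0).
  apply: (@filter_forall _ _ _ (nbhs (0 : R))) => s.
  apply: (@filter_forall _ _ _ (nbhs (0 : R))) => j.
  pose x := solution (idx s) (y + t0 *: w).
  pose h := w *m invmx (A (idx s)).
  have vE r : side s j (solution (idx s) (y + (t0 + r) *: w)) =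
      side s j x + r * (side s j (x + h) - side s j x).
    rewrite -(side_affine u e s j x (x + h) r) scalerDl addrA solution_shift.
    by rewrite -scalemxAl [x + h]addrC addrK.
  have [v0|v0|v0] := ltrgt0P (side s j x).
  - apply: filterS (affine_pos_near (side s j (x + h) - side s j x) v0) => r rP.
    rewrite /= vE -/x; split=> [_|]; [exact: rP|].
    by rewrite (lt_gtF v0).
  - have v0' : 0 < - side s j x by rewrite oppr_gt0.
    apply: filterS (affine_pos_near (- (side s j (x + h) - side s j x)) v0') => r rP.
    rewrite /= vE -/x; split=> [|_]; first by rewrite (lt_gtF v0).
    by have := rP; rewrite mulrN -opprD oppr_gt0.
  - by apply: nearW => r /=; rewrite -/x v0 ltxx.
move=> /nbhs_norm_exP[r r0 rP]; apply/nbhs_norm_exP; exists r => // t tr s j /=.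
have := rP (t - t0); rewrite subr0 => /(_ tr s j) /=.
by rewrite (_ : t0 + (t - t0) = t)//; ring.
Qed.

(** Cells whose candidate at [t0] lies on a wall are paired with their neighbours across it, and the
    changes of weight in a pair cancel; every other weight is unchanged near [t0]. *)
Lemma cell_sum_locally_constant (t0 : R) :
  \forall t \near t0, cell_sum (y + t *: w) = cell_sum (y + t0 *: w).
Proof.
apply: filterS (sides_near t0) => t tP.
pose x s := solution (idx s) (y + t0 *: w).
pose x' s := solution (idx s) (y + t *: w).
pose touching s := nonempty_cell s && `[< closed_cell s (x s) >].
(* By transversality the wall picked here is the only possible one, and the neighbour has the same
   candidate at [t0]; hence [tau] is an involution. *)
pose tau s := if touching s then
  (if [pick j | l j (x s) == 0] is Some j then flip j s else s) else s.
pose delta s := if nonempty_cell s then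
  cell_weight s (y + t *: w) - cell_weight s (y + t0 *: w) else 0.
have others s j : l j (x s) = 0 -> forall i, i != j -> l i (x s) != 0.
  by move=> lj i ij; apply: (transverse _ lj); rewrite eq_sym.
have tau_flip s j : touching s -> l j (x s) = 0 -> tau s = flip j s.
  move=> ts lj; rewrite /tau ts; case: pickP => [i /eqP li|/(_ j)]; last by rewrite lj eqxx.
  have [->//|ij] := eqVneq i j.
  by have := others s j lj i ij; rewrite li eqxx.
have flip_touching s j : touching s -> l j (x s) = 0 ->
    touching (flip j s) /\ x (flip j s) = x s.
  move=> /andP[sne /asboolP sx] lj.
  have fne := flip_nonempty lj (others s j lj) sx sne.
  have fx := flip_closed_cell lj sx.
  have xx : x (flip j s) = x s.
    have yE : y + t0 *: w = piece (idx (flip j s)) (x s).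
      rewrite -(closed_cell_idx GAb wall_sep idxP fne fx).
      by rewrite (closed_cell_idx GAb wall_sep idxP sne sx) piece_solution.
    by rewrite {1}/x yE solution_piece.
  by split => //; rewrite /touching fne xx; apply/asboolP.
have deltaE s j : touching s -> l j (x s) = 0 ->
    delta s = Num.sg (\det (A (idx s))) * Num.sg (side s j (x' s)) / 2.
  move=> /andP[sne /asboolP sx] lj; rewrite /delta sne /cell_weight -/(x s) -/(x' s).
  have one i : i != j -> half_sign (side s i (x s)) = 1 /\
      half_sign (side s i (x' s)) = 1.
    move=> ij; have si : 0 < side s i (x s).
      by rewrite lt_neqAle eq_sym side_eq0 (others s j lj i ij) sx.
    by split; apply: half_sign_gt0 => //; apply: (tP s i).1.
  rewrite (bigD1 j)//= big1 => [|i ij]; last exact: (one i ij).2.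
  rewrite [in X in _ - X](bigD1 j)//= big1 => [|i ij]; last exact: (one i ij).1.
  have -> : side s j (x s) = 0 by rewrite /side lj mulr0.
  by rewrite !mulr1 -mulrBr half_sign_sub0 mulrA.
have delta0 s : ~ (exists2 j, touching s & l j (x s) = 0) -> delta s = 0.
  move=> no; rewrite /delta; case: ifP => // sne; rewrite /cell_weight -/(x s) -/(x' s).
  have [sx|/existsNP[j]] := pselect (closed_cell s (x s)); last first.
    move=> /negP; rewrite -ltNge => sj.
    rewrite (bigD1 j)//= half_sign_lt0; last exact: (tP s j).2.
    by rewrite [in X in _ - X](bigD1 j)//= half_sign_lt0// !mul0r !mulr0 subrr.
  have pos j : 0 < side s j (x s).
    rewrite lt_neqAle sx andbT eq_sym side_eq0; apply/eqP => lj; apply: no.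
    by exists j => //; rewrite /touching sne; apply/asboolP.
  rewrite big1 => [|j _]; last by apply: half_sign_gt0; apply: (tP s j).1; exact: pos.
  by rewrite big1 ?subrr// => j _; exact: half_sign_gt0.
have tauK : involutive tau.
  move=> s; case: (boolP (touching s)) => ts; last by rewrite /tau (negPf ts) (negPf ts).
  have [[j lj]|no] := pselect (exists j, l j (x s) = 0).
    have [fts fx] := flip_touching s j ts lj.
    by rewrite (tau_flip s j ts lj) (tau_flip (flip j s) j) ?fx// flipK.
  have tt : tau s = s.
    by rewrite /tau ts; case: pickP => // j /eqP lj; case: no; exists j.
  by rewrite !tt.
have deltaN s : delta s + delta (tau s) = 0.
  have [[j ts lj]|no] := pselect (exists2 j, touching s & l j (x s) = 0); last first.
    suff -> : tau s = s by rewrite delta0// addr0.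
    rewrite /tau; case: ifP => // ts; case: pickP => // j /eqP lj.
    by case: no; exists j.
  have [fts fx] := flip_touching s j ts lj.
  rewrite (tau_flip s j ts lj) (deltaE s j)// (deltaE (flip j s) j) ?fx//.
  rewrite -mulrDl; have /andP[sne /asboolP sx] := ts.
  have := crossing_signs GAb A_unit wall_sep idxP ((t - t0) *: w) lj (others s j lj) sx sne.
  have xE r : x' r = x r + ((t - t0) *: w) *m invmx (A (idx r)).
    by rewrite /x' /x -solution_shift -addrA -scalerDl [t0 + _]addrC subrK.
  by rewrite !xE fx => ->; rewrite mul0r.
apply/eqP; rewrite -subr_eq0 /cell_sum -sumrB big_mkcond -/delta; apply/eqP.
(* Reindexing by [tau] shows that twice the total change is zero; fixed points need no separate
   count. *)
have sum_tau : \sum_s delta s = \sum_s delta (tau s).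
  by rewrite (reindex_inj (inv_inj tauK)).
have : \sum_s delta s + \sum_s delta s = 0.
  by rewrite {2}sum_tau -big_split/= big1.
rewrite /delta; lra.
Qed.

Lemma cell_sum_line : cell_sum y = cell_sum (y + w).
Proof.
have := @constant_of_locally _ (fun t => cell_sum (y + t *: w)) 0 1.
rewrite scale0r addr0 scale1r; apply=> t0; exact: cell_sum_locally_constant.
Qed.

End Line.

(** * Walls up to proportionality; constancy of the index sum on generic values *)

Lemma wall0 (R : realType) (n : nat) (x : 'rV[R]_n) : wall 0 0 x = 0.
Proof. by rewrite /wall mulmx0 mxE addr0. Qed.

Lemma wall_inj (R : realType) (n : nat) (p p' : 'cV[R]_n * R) :
  (forall x, wall p.1 p.2 x = wall p'.1 p'.2 x) -> p = p'.
Proof.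
case: p p' => [v c] [v' c'] /= E.
have cc : c = c' by have := E 0; rewrite /wall !mul0mx mxE !add0r.
subst c'; congr (_, _); apply/colP => i; have := E (delta_mx 0 i).
by rewrite /wall => /addIr; rewrite -!rowE !mxE.
Qed.

Lemma wall_neq0 (R : realType) (n : nat) (p : 'cV[R]_n * R) :
  p != 0 -> exists x, wall p.1 p.2 x != 0.
Proof.
move=> p0; apply: contrapT => no; case/eqP: p0; apply: wall_inj => x /=.
by rewrite wall0; apply/eqP; apply: contraPT no => px; apply; exists x.
Qed.

Definition wall_scale (R : realType) (n : nat) (a : R) (p : 'cV[R]_n * R) :=
  (a *: p.1, a * p.2).

Lemma wall_scaleE (R : realType) (n : nat) (a : R) (p : 'cV[R]_n * R) x :
  wall (wall_scale a p).1 (wall_scale a p).2 x = a * wall p.1 p.2 x.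
Proof. by rewrite /wall /= -scalemxAr mxE mulrDr. Qed.

(** Two proportional functionals define the same hyperplane, and a line that meets it would violate
    transversality at once; one representative per class is kept. *)
Lemma nonproportional_walls (R : realType) (n : nat) (s : seq ('cV[R]_n * R)) :
  0 \notin s ->
  exists s', [/\ 0 \notin s', uniq s',
    forall p p' a, p \in s' -> p' \in s' -> p != p' -> p != wall_scale a p' &
    forall p, p \in s -> exists2 p', p' \in s' & exists a, p = wall_scale a p'].
Proof.
elim: s => [|p s IH]; first by exists [::]; split.
rewrite inE negb_or => /andP[p0 /IH[s' [s'0 us' ps' ss']]].
have [[p' p's' pp']|no] := pselect (exists2 p', p' \in s' & exists a, p = wall_scale a p').
  by exists s'; split => // p1; rewrite inE => /predU1P[->|/ss'//]; exists p'.
exists (p :: s'); split.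
- by rewrite inE negb_or p0.
- rewrite /= us' andbT; apply/negP => ps; apply: no; exists p => //; exists 1.
  by rewrite /wall_scale scale1r mul1r; case: p {p0 ps}.
- move=> p1 p2 a; rewrite !inE => /predU1P[->|p1s] /predU1P[->|p2s] p12.
  + by rewrite eqxx in p12.
  + by apply/eqP => pE; apply: no; exists p2 => //; exists a.
  + apply/eqP => pE; apply: no; exists p1 => //; exists a^-1.
    have a0 : a != 0.
      apply: contraNneq s'0 => a0.
      by move: p1s; rewrite pE a0 /wall_scale scale0r mul0r.
    rewrite pE /wall_scale /= scalerA mulrA mulVf// scale1r mul1r.
    by rewrite -surjective_pairing.
  + exact: ps'.
- move=> p1; rewrite inE => /predU1P[->|/ss'[p' p's' pa]].
    exists p; rewrite ?mem_head//; exists 1; rewrite /wall_scale scale1r mul1r.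
    by rewrite -surjective_pairing.
  by exists p' => //; rewrite inE p's' orbT.
Qed.

Lemma affine_comp_solution (R : realType) (n k : nat) (A : 'I_k -> 'M[R]_n)
    (b : 'I_k -> 'rV[R]_n) (f : 'rV[R]_n -> R) i :
  affine_fun f -> affine_fun (fun y => f (solution A b i y)).
Proof.
move=> fa x y t; rewrite -fa; congr f; rewrite /solution.
rewrite addrAC mulmxDl -scalemxAl; congr (_ + _ *: _).
by rewrite -mulmxBl opprB addrA subrK.
Qed.

(** Two generic values need not be joined by a transverse segment, but both can be joined by one to
    a suitable third value. The exceptional set is left abstract: callers only have to avoid
    finitely many nonzero affine functions. *)
Lemma index_sum_generic (R : realType) (n k : nat) (G : 'rV[R]_n -> 'rV[R]_n)
    (A : 'I_k -> 'M[R]_n) (b : 'I_k -> 'rV[R]_n) :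
  composed_of G A b -> (forall i, A i \in unitmx) ->
  exists (I : finType) (m : I -> 'rV[R]_n -> R),
    [/\ forall i, affine_fun (m i), forall i, exists z, m i z != 0 &
        forall y y', (forall i, m i y != 0) -> (forall i, m i y' != 0) ->
          index_sum G y = index_sum G y'].
Proof.
move=> GAb Au.
pose gap (t : 'I_k * 'I_k * 'I_n) : 'cV[R]_n * R :=
  (col t.2 (A t.1.1 - A t.1.2), (b t.1.1 - b t.1.2) ord0 t.2).
pose s0 := [seq p <- [seq gap t | t <- enum {: 'I_k * 'I_k * 'I_n}] | p != 0].
have gapE i i' c x : wall (gap (i, i', c)).1 (gap (i, i', c)).2 x =
    (x *m A i + b i) ord0 c - (x *m A i' + b i') ord0 c.
  have colE (M : 'M[R]_n) : (x *m col c M) ord0 ord0 = (x *m M) ord0 c.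
    by rewrite !mxE; apply: eq_bigr => j _; rewrite mxE.
  rewrite /wall /= colE mulmxBr; move: (x *m A i) (x *m A i') => v w.
  by rewrite !mxE; ring.
have [|s' [s'0 us' s'np s's0]] := @nonproportional_walls _ _ s0.
  by rewrite mem_filter eqxx.
pose q := size s'; pose u (j : 'I_q) := (nth 0 s' j).1.
pose e (j : 'I_q) := (nth 0 s' j).2.
have wall_sep i i' c x : (forall j, wall (u j) (e j) x != 0) ->
    (x *m A i + b i) ord0 c = (x *m A i' + b i') ord0 c ->
    forall z, (z *m A i + b i) ord0 c = (z *m A i' + b i') ord0 c.
  move=> lx xE z; apply/eqP; rewrite -subr_eq0 -gapE.
  have [->|g0] := eqVneq (gap (i, i', c)) 0; first by rewrite wall0.
  have gs : gap (i, i', c) \in s0 by rewrite mem_filter g0 map_f// mem_enum.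
  have [p ps' [a ga]] := s's0 _ gs.
  have := gapE i i' c x; rewrite xE subrr ga wall_scaleE => /eqP.
  rewrite mulf_eq0 => /orP[/eqP a0|].
    by move: g0; rewrite ga a0 /wall_scale scale0r mul0r eqxx.
  have pj : (index p s' < q)%N by rewrite index_mem.
  by have := lx (Ordinal pj); rewrite /u /e /= nth_index// => /negPf ->.
have [i0 _] := GAb.2 0.
have [idx idxP] : {idx : {ffun 'I_q -> bool} -> 'I_k &
    forall s x, in_cell u e s x -> G x = x *m A (idx s) + b (idx s)}.
  apply: (@choice _ _ (fun s i => forall x, in_cell u e s x -> G x = x *m A i + b i)).
  move=> s; have [[p sp]|no] := pselect (exists p, in_cell u e s p).
    have [i Gp] := GAb.2 p; exists i => x sx.
    exact: (cell_piece GAb wall_sep sp sx Gp).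
  by exists i0 => x sx; case: no; exists x.
(* Wall [ij.2] transported to the space of values by piece [ij.1]. *)
pose m (ij : 'I_k * 'I_q) y := wall (u ij.2) (e ij.2) (solution A b ij.1 y).
have maff ij : affine_fun (m ij) by apply/affine_comp_solution/wall_affine.
have nth0 (j : 'I_q) : nth 0 s' j != 0.
  by apply: contraNneq s'0 => <-; apply: mem_nth.
have mne ij : exists z, m ij z != 0.
  have [x xj] := wall_neq0 (nth0 ij.2).
  by exists (x *m A ij.1 + b ij.1); rewrite /m solution_piece.
exists _, m; split => // y y' yg y'g.
(* For generic [y], if [pair y (i, j, j') z != 0], then the line through [y] and
   [z] avoids the image under the i-th piece of the intersection of the walls j
   and j'. *)
pose pair y (t : 'I_k * 'I_q * 'I_q) z : R := if t.1.2 == t.2 then 1 else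
  m t.1 y * m (t.1.1, t.2) z - m (t.1.1, t.2) y * m t.1 z.
have pair_aff x t : affine_fun (pair x t).
  move=> z z' r; rewrite /pair; case: ifP => _; first by rewrite subrr mulr0 addr0.
  by rewrite !maff; ring.
have pair_ne x t : (forall ij, m ij x != 0) -> exists z, pair x t z != 0.
  move=> xg; case: t => [[i j] j'].
  have [->|jj'] := eqVneq j j'; first by exists 0; rewrite /pair eqxx oner_eq0.
  apply: contrapT => no.
  (* If [pair] vanished identically, wall [j'] would be this multiple of wall [j]. *)
  have np := s'np (nth 0 s' j') (nth 0 s' j) (m (i, j') x / m (i, j) x)
    (mem_nth _ (ltn_ord _)) (mem_nth _ (ltn_ord _)).
  have /np/eqP : nth 0 s' j' != nth 0 s' j by rewrite nth_uniq// eq_sym.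
  apply.
  apply: wall_inj => z; rewrite wall_scaleE.
  apply: (mulfI (xg (i, j))); rewrite mulrA mulrCA divff ?mulr1//.
  have : m (i, j) x * m (i, j') (z *m A i + b i) -
      m (i, j') x * m (i, j) (z *m A i + b i) = 0.
    apply/eqP; apply: contraPT no => h; apply; exists (z *m A i + b i).
    by rewrite /pair /= (negPf jj').
  by rewrite /m /= solution_piece// => /eqP; rewrite subr_eq0 => /eqP.
pose f (t : 'I_k * 'I_q + 'I_k * 'I_q * 'I_q * bool) z := match t with
  | inl ij => m ij z | inr (t', h) => pair (if h then y else y') t' z end.
have faff t : affine_fun (f t) by case: t => [ij|[t h]]; [exact: maff|exact: pair_aff].
have fne t : exists z, f t z != 0.
  by case: t => [ij|[t [|]]] /=; [exact: mne|exact: pair_ne..].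
have [y2 _ y2f] := affine_avoid 0 faff fne ltr01.
have y2g ij : m ij y2 != 0 by exact: y2f (inl ij).
have to_y2 x : (forall ij, m ij x != 0) -> (forall t, pair x t y2 != 0) ->
    cell_sum A b u e idx x = cell_sum A b u e idx y2.
  move=> xg xp; rewrite -[in RHS](subrK x y2) [in RHS]addrC.
  apply: (cell_sum_line GAb Au wall_sep idxP) => i j j' t jj' lj0.
  apply/eqP => lj'0.
  have mE j1 : wall (u j1) (e j1) (solution A b i (x + t *: (y2 - x))) =
      m (i, j1) x + t * (m (i, j1) y2 - m (i, j1) x) by exact: (maff (i, j1)).
  move: lj0 lj'0 (xp (i, j, j')); rewrite !mE /pair /= (negPf jj') => h1 h2 h3.
  (* Eliminating the constant terms from the two vanishing walls leaves [t] times the nonzero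
     [pair]; and [t = 0] is excluded because [x] is generic. *)
  have t0 : t * (m (i, j) x * m (i, j') y2 - m (i, j') x * m (i, j) y2) = 0.
    move: (m (i, j) x) (m (i, j') x) (m (i, j) y2) (m (i, j') y2) h1 h2 => a1 a2 a3 a4.
    move=> h1 h2.
    transitivity (a1 * (a2 + t * (a4 - a2)) - a2 * (a1 + t * (a3 - a1))); first ring.
    by rewrite h1 h2 !mulr0 subrr.
  move/eqP: t0; rewrite mulf_eq0 (negPf h3) orbF => /eqP t0.
  by move: h1; rewrite t0 mul0r addr0; apply/eqP.
have link x : (forall ij, m ij x != 0) -> (index_sum G x)%:~R = cell_sum A b u e idx x.
  by move=> xg; apply: index_cell_sum => // i j; exact: xg (i, j).
apply: (@intr_inj R); rewrite !link// !to_y2//.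
- by move=> t; exact: (y2f (inr (t, false))).
- by move=> t; exact: (y2f (inr (t, true))).
Qed.

(** * Degree of piecewise affine maps *)

Lemma index_sum_add_cst (R : realType) (n : nat) (G : 'rV[R]_n -> 'rV[R]_n)
    (c y : 'rV[R]_n) :
  (forall x, G x + c = y -> exists M, affine_near (fun x => G x + c) x M) ->
  index_sum (fun x => G x + c) y = index_sum G (y - c).
Proof.
move=> HM; rewrite /index_sum.
have -> : G @^-1` [set y - c] = (fun x => G x + c) @^-1` [set y].
  by apply/seteqP; split=> x /= => [->|<-]; rewrite ?subrK ?addrK.
apply: eq_fsbigr => x; rewrite inE => /= /HM[M Mx].
have GM : affine_near G x M.
  by apply: filterS Mx => z; rewrite addrAC => /addIr.
by have [_ ->] := affine_near_jacobian Mx; have [_ ->] := affine_near_jacobian GM.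
Qed.

(** Moving the value slightly towards a generic [z] amounts to adding a small constant to [G], an
    affine perturbation to which stability applies. *)
Lemma index_sum_regular_generic (R : realType) (n k : nat)
    (G : 'rV[R]_n -> 'rV[R]_n) (A : 'I_k -> 'M[R]_n) (b : 'I_k -> 'rV[R]_n)
    (I : finType) (m : I -> 'rV[R]_n -> R) y :
  composed_of G A b -> coercive G -> (forall i, affine_fun (m i)) ->
  (forall i, exists z, m i z != 0) -> regular_value G y ->
  exists2 y', index_sum G y' = index_sum G y & forall i, m i y' != 0.
Proof.
move=> GAb Gco maff mne yreg; have [yfin yM] := regular_preimage GAb yreg.
have [z _ zm] := affine_avoid 0 maff mne ltr01.
have Dl : linearly_bounded (fun _ : 'rV[R]_n => y - z).
  by exists `|y - z|; split=> // x; rewrite ler_peMr// lerDr.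
have Daff x : G x = y -> exists P, affine_near (fun _ : 'rV[R]_n => y - z) x P.
  move=> _; exists 0; apply/nbhs_norm_exP; exists 1 => // w _.
  by rewrite mulmx0 addr0.
have := index_sum_stable GAb.1 Gco Dl yfin yM Daff.
move=> /nbhs_norm_exP[r r0 rP].
have [|t /andP[t0 tr] tm] := @affine_line_avoid _ _ _ (enum I) m y z r maff _ r0.
  by move=> i _; right.
have [|Hreg _ Hsum] := rP t; first by rewrite subr0 gtr0_norm.
have shiftE : y - t *: (y - z) = y + t *: (z - y) by rewrite -scalerN opprB.
have tm' i : m i (y + t *: (z - y)) != 0 by apply: tm; rewrite mem_enum.
have Hsum' : index_sum (fun x => G x + t *: (y - z)) y = index_sum G (y - t *: (y - z)).
  apply: index_sum_add_cst.
  by move=> x /Hreg[M _]; exists M.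
exists (y + t *: (z - y)); last exact: tm'.
rewrite -shiftE -Hsum'.
exact: Hsum.
Qed.

Lemma index_sum_regular_unit (R : realType) (n k : nat)
    (G : 'rV[R]_n -> 'rV[R]_n) (A : 'I_k -> 'M[R]_n) (b : 'I_k -> 'rV[R]_n) y y' :
  composed_of G A b -> (forall i, A i \in unitmx) -> coercive G ->
  regular_value G y -> regular_value G y' -> index_sum G y = index_sum G y'.
Proof.
move=> GAb Au Gco yreg y'reg.
have [I [m [maff mne mconst]]] := index_sum_generic GAb Au.
have [y1 <- y1m] := index_sum_regular_generic GAb Gco maff mne yreg.
have [y2 <- y2m] := index_sum_regular_generic GAb Gco maff mne y'reg.
exact: mconst.
Qed.

Lemma poly_nonroot (R : realType) (p : {poly R}) (r : R) : p != 0 -> 0 < r ->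
  exists2 t, 0 < t < r & p.[t] != 0.
Proof.
(* More points than [p] can have roots; the shift [i.+2] keeps them strictly below [r]. *)
move=> p0 r0; pose s := [seq r / i.+2%:R | i <- iota 0 (size p)].
have us : uniq s.
  rewrite map_inj_uniq ?iota_uniq// => i j /(mulfI (lt0r_neq0 r0))/invr_inj/eqP.
  by rewrite eqr_nat => /eqP[].
have /allPn[t /mapP[i _ tE] pt] : ~~ all (root p) s.
  apply/negP => ps; have := max_poly_roots p0 ps us.
  by rewrite size_map size_iota ltnn.
exists t; last exact: pt.
by rewrite tE divr_gt0 ?ltr0n//= ltr_pdivrMr ?ltr0n// ltr_pMr// ltr1n.
Qed.

(** The determinant of [A i + t *: 1%:M] is the characteristic polynomial of [- A i] at [t], and a
    product of monic polynomials is nonzero. *)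
Lemma unitmx_add_scalar (R : realType) (n k : nat) (A : 'I_k -> 'M[R]_n) (r : R) :
  0 < r -> exists2 t, 0 < t < r & forall i, A i + t *: 1%:M \in unitmx.
Proof.
move=> r0; pose p := \prod_i char_poly (- A i).
have p0 : p != 0.
  by apply: monic_neq0; apply: monic_prod => i _; exact: char_poly_monic.
have [t tr pt] := poly_nonroot p0 r0; exists t => // i.
rewrite unitmxE unitfE; apply: contraNneq pt => dt.
have cE : (char_poly (- A i)).[t] = \det (A i + t *: 1%:M).
  rewrite -[LHS]/(horner_eval t _) -det_map_mx; congr (\det _).
  apply/matrixP => j j'; rewrite !mxE /= /horner_eval hornerD hornerN hornerC.
  by rewrite hornerMn hornerX mulr_natr opprK addrC.
by rewrite horner_prod (bigD1 i)//= cE dt mul0r.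
Qed.

Lemma composed_add_id (R : realType) (n k : nat) (G : 'rV[R]_n -> 'rV[R]_n)
    (A : 'I_k -> 'M[R]_n) (b : 'I_k -> 'rV[R]_n) (t : R) :
  composed_of G A b ->
  composed_of (fun x => G x + t *: x) (fun i => A i + t *: 1%:M) b.
Proof.
move=> [Gc GAb]; split.
  have tc : continuous (fun x : 'rV[R]_n => t *: x).
    apply: (@lipschitz_continuous _ _ _ _ `|t|) => x z.
    by rewrite -scalerBr normrZ.
  by move=> x; apply: continuousD; [exact: Gc|exact: tc].
move=> x; have [i ->] := GAb x; exists i.
by rewrite mulmxDr -scalemxAr mulmx1 addrAC.
Qed.

Lemma index_sum_regular (R : realType) (n : nat) (G : 'rV[R]_n -> 'rV[R]_n) y y' :
  piecewise_affine G -> coercive G ->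
  regular_value G y -> regular_value G y' -> index_sum G y = index_sum G y'.
Proof.
move=> [k [A [b GAb]]] Gco yreg y'reg.
have Dl : linearly_bounded (fun x : 'rV[R]_n => x).
  by exists 1; split=> // x; rewrite mul1r lerDl.
have stable z : regular_value G z -> \forall t \near (0 : R),
    regular_value (fun x => G x + t *: x) z /\
    index_sum (fun x => G x + t *: x) z = index_sum G z.
  move=> zreg; have [zfin zM] := regular_preimage GAb zreg.
  have Daff x : G x = z -> exists P, affine_near (fun x : 'rV[R]_n => x) x P.
    move=> _; exists 1%:M; apply/nbhs_norm_exP; exists 1 => // w _.
    by rewrite mulmx1 addrC subrK.
  have := index_sum_stable GAb.1 Gco Dl zfin zM Daff.
  move=> /nbhs_norm_exP[r r0 rP]; apply/nbhs_norm_exP.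
  exists r; first exact: r0.
  move=> t tr; have [HM _ Hsum] := rP t tr.
  by split; [exact: affine_regular_value HM|exact: Hsum].
have [r r0 rP] := (nbhs_norm_exP _ _).1
  (filterI (filterI (stable y yreg) (stable y' y'reg)) (coercive_perturb Gco Dl)).
(* Adding a small multiple of the identity makes all the pieces invertible. *)
have [t /andP[t0 tr] tu] := unitmx_add_scalar A r0.
have [|[[r1 <-] [r2 <-]] Hco] := rP t; first by rewrite subr0 gtr0_norm.
exact: index_sum_regular_unit (composed_add_id t GAb) tu Hco r1 r2.
Qed.

(** * Existence of generic regular values *)

(** Identical coordinates give the constant 1 instead of 0, so that no function in the family
    vanishes identically and avoidance applies to all of them. *)
Definition gap_fun (R : realType) (n m k : nat) (A : 'I_k -> 'M[R]_(n, m))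
    (b : 'I_k -> 'rV[R]_m) (t : 'I_k * 'I_k * 'I_m) (z : 'rV[R]_n) : R :=
  let d z := (z *m A t.1.1 + b t.1.1) ord0 t.2 - (z *m A t.1.2 + b t.1.2) ord0 t.2 in
  if `[< forall z, d z = 0 >] then 1 else d z.

Lemma piece_affine_fun (R : realType) (n m : nat) (A : 'M[R]_(n, m)) (b : 'rV[R]_m) c :
  affine_fun (fun z => (z *m A + b) ord0 c).
Proof.
move=> x z t; rewrite mulmxDl -scalemxAl mulmxBl.
by move: (x *m A) (z *m A) => v w; rewrite !mxE; ring.
Qed.

Lemma gap_fun_affine (R : realType) (n m k : nat) (A : 'I_k -> 'M[R]_(n, m))
    (b : 'I_k -> 'rV[R]_m) t : affine_fun (gap_fun A b t).
Proof.
move=> x z r; rewrite /gap_fun; case: asboolP => _.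
  by rewrite subrr mulr0 addr0.
rewrite (piece_affine_fun (A t.1.1) (b t.1.1) t.2 x z r).
by rewrite (piece_affine_fun (A t.1.2) (b t.1.2) t.2 x z r); ring.
Qed.

Lemma gap_fun_neq0 (R : realType) (n m k : nat) (A : 'I_k -> 'M[R]_(n, m))
    (b : 'I_k -> 'rV[R]_m) t : exists z, gap_fun A b t z != 0.
Proof.
rewrite /gap_fun; case: asboolP => [_|/existsNP[z /eqP dz]]; last by exists z.
by exists 0; rewrite oner_eq0.
Qed.

(** Any piece active near [x] is active at [x]; there it agrees with piece [i], so by genericity all
    its coordinates are identical to those of piece [i]. *)
Lemma gap_fun_affine_near (R : realType) (n m k : nat) (G : 'rV[R]_n -> 'rV[R]_m)
    (A : 'I_k -> 'M[R]_(n, m)) (b : 'I_k -> 'rV[R]_m) x i :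
  composed_of G A b -> (forall t, gap_fun A b t x != 0) -> G x = x *m A i + b i ->
  affine_near G x (A i).
Proof.
move=> GAb xg Gx; have [r r0 rP] := (nbhs_norm_exP _ _).1 (composed_active x GAb).
apply/nbhs_norm_exP; exists r => // z zr; have [i' Gx' Gz] := rP z zr.
suff -> : G z = z *m A i + b i.
  rewrite Gx mulmxBl; move: (z *m A i) (x *m A i) => v w.
  by apply/rowP => c; rewrite !mxE; ring.
rewrite Gz; apply/rowP => c; apply/eqP; rewrite -subr_eq0; apply/eqP.
have := xg (i', i, c); rewrite /gap_fun; case: asboolP => [h _|_]; first exact: h.
by rewrite /= -Gx' -Gx subrr eqxx.
Qed.

(** A finite form of Sard's theorem: the images of singular pieces lie in hyperplanes, and
    invertible pieces carry the zero sets of the [F t] to hyperplanes. A value off all of these has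
    only good preimages. *)
Lemma composed_generic_value (R : realType) (n k : nat) (G : 'rV[R]_n -> 'rV[R]_n)
    (A : 'I_k -> 'M[R]_n) (b : 'I_k -> 'rV[R]_n) (I : finType)
    (f : I -> 'rV[R]_n -> R) :
  composed_of G A b -> (forall i, affine_fun (f i)) ->
  (forall i, exists z, f i z != 0) ->
  exists y, forall x, G x = y ->
    (exists2 M, M \in unitmx & affine_near G x M) /\ forall i, f i x != 0.
Proof.
move=> GAb faff fne.
pose F (t : 'I_k * 'I_k * 'I_n + I) := match t with
  inl t => gap_fun A b t | inr i => f i end.
have Faff t : affine_fun (F t) by case: t => [t|i]; [exact: gap_fun_affine|exact: faff].
have Fne t : exists z, F t z != 0 by case: t => [t|i]; [exact: gap_fun_neq0|exact: fne].
(* A kernel vector [v i] of a singular [A i] is constant on the image of piece [i], so it defines a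
   hyperplane containing that image. *)
have [v v_] : {v : 'I_k -> 'cV[R]_n &
    forall i, A i \notin unitmx -> v i != 0 /\ A i *m v i = 0}.
  apply: (@choice _ _ (fun i v => A i \notin unitmx -> v != 0 /\ A i *m v = 0)) => i.
  have [Ai|] := boolP (A i \in unitmx); first by exists 0.
  rewrite unitmxE unitfE negbK -det_tr => /det0P[w w0 wA]; exists w^T => _.
  split; first by rewrite -[0]trmx0 (inj_eq (@trmx_inj _ _ _)).
  by apply: trmx_inj; rewrite trmx_mul trmxK wA trmx0.
pose g (t : 'I_k + 'I_k * ('I_k * 'I_k * 'I_n + I)) : 'rV[R]_n -> R := match t with
  | inl i => if A i \in unitmx then fun=> 1 else wall (v i) (- (b i *m v i) ord0 ord0)
  | inr (i, t) => if A i \in unitmx then fun y => F t (solution A b i y) else fun=> 1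
  end.
have one_aff : affine_fun (fun _ : 'rV[R]_n => 1 : R).
  by move=> x z r; rewrite subrr mulr0 addr0.
have gaff t : affine_fun (g t).
  case: t => [i|[i t]] /=; case: ifP => _ //; first exact: wall_affine.
  exact: affine_comp_solution.
have gne t : exists z, g t z != 0.
  case: t => [i|[i t]] /=; case: ifPn => Au; try by exists 0; rewrite oner_eq0.
    have [v0 _] := v_ i Au.
    by apply: (@wall_neq0 _ _ (v i, _)); apply: contraNneq v0 => -[->].
  have [z Fz] := Fne t; exists (z *m A i + b i).
  by rewrite /solution addrK mulmxK.
have [y _ yg] := affine_avoid 0 gaff gne ltr01.
exists y => x Gx; have [i Gxi] := GAb.2 x.
have Au : A i \in unitmx.
  apply/negPn/negP => Au; have [v0 Av] := v_ i Au.
  have := yg (inl i); rewrite /g (negPf Au) /wall -Gx Gxi mulmxDl -mulmxA Av mulmx0.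
  by rewrite add0r subrr eqxx.
have xF t : F t x != 0.
  have := yg (inr (i, t)); rewrite /g Au.
  by rewrite -Gx Gxi /solution addrK mulmxK.
split; last by move=> j; exact: (xF (inr j)).
exists (A i) => //; apply: gap_fun_affine_near GAb _ Gxi => t.
exact: (xF (inl t)).
Qed.

Lemma is_degree_index_sum (R : realType) (n : nat) (G : 'rV[R]_n -> 'rV[R]_n) y :
  piecewise_affine G -> coercive G -> regular_value G y ->
  is_degree G (index_sum G y).
Proof.
move=> GPA Gco yreg y' y'reg; split.
  have [k [A [b GAb]]] := GPA.
  by have [] := regular_preimage GAb y'reg.
exact: (index_sum_regular GPA Gco yreg y'reg).
Qed.

(** Uniqueness of the degree rests on this: without a regular value every integer would satisfy
    [is_degree]. *)
Lemma piecewise_affine_regular_value (R : realType) (n : nat)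
    (G : 'rV[R]_n -> 'rV[R]_n) :
  piecewise_affine G -> exists y, regular_value G y.
Proof.
move=> [k [A [b GAb]]].
have [|i|y yP] := @composed_generic_value _ _ _ _ _ _ void (fun=> cst 1) GAb.
- by case.
- by case: i.
by exists y; apply: affine_regular_value => x /yP[].
Qed.

Lemma degree_index_sum (R : realType) (n : nat) (G : 'rV[R]_n -> 'rV[R]_n) y :
  piecewise_affine G -> coercive G -> regular_value G y ->
  degree G = index_sum G y.
Proof.
move=> GPA Gco yreg; have dG := is_degree_index_sum GPA Gco yreg.
have /(_ y yreg)[_ //] : is_degree G (degree G).
by apply: (@xgetPex _ 0 [set d | is_degree G d]); exists (index_sum G y).
Qed.

Lemma coercive_degree_well_defined (R : realType) (n : nat)
    (G : 'rV[R]_n -> 'rV[R]_n) :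
  piecewise_affine G -> coercive G -> degree_well_defined G.
Proof.
move=> GPA Gco; split => //; last first.
  have [y yreg] := piecewise_affine_regular_value GPA.
  exists (index_sum G y); split; first exact: is_degree_index_sum.
  by move=> d /(_ y yreg)[_ ->].
have Gc : continuous G by have [k [A [b []]]] := GPA.
split => // C Cc; apply: bounded_closed_compact; last first.
  by apply: closed_comp => [x _|]; [exact: Gc|exact: compact_closed (@norm_hausdorff _ _) Cc].
have [c [C' [c0 GC]]] := Gco.
have [M [_ MC]] := compact_bounded Cc.
exists ((M + 1 + C') / c); split; first exact: num_real.
move=> N NM x /= Cx; rewrite (le_trans _ (ltW NM))// ler_pdivlMr// mulrC.
apply: le_trans (GC x) _; rewrite lerD2r.
by apply: (MC (M + 1)); rewrite ?ltrDl.
Qed.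

(** * Homotopy invariance of the degree *)

Lemma piecewise_affine_perturb (R : realType) (n m : nat)
    (G D : 'rV[R]_n -> 'rV[R]_m) (t : R) :
  piecewise_affine G -> piecewise_affine D ->
  piecewise_affine (fun x => G x + t *: D x).
Proof.
move=> [k [A [b [Gc GAb]]]] [k' [A' [b' [Dc DAb]]]].
pose T := ('I_k * 'I_k')%type.
exists #|{: T}|, (fun i => let ij := enum_val i in A ij.1 + t *: A' ij.2),
  (fun i => let ij := enum_val i in b ij.1 + t *: b' ij.2).
split.
  have tc : continuous (fun x : 'rV[R]_m => t *: x).
    apply: (@lipschitz_continuous _ _ _ _ `|t|) => x z.
    by rewrite -scalerBr normrZ.
  have tDc : continuous (fun x => t *: D x).
    move=> x; exact: (@continuous_comp _ _ _ D (fun z => t *: z) x (Dc x) (tc _)).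
  have h x : {for x, continuous (G + (fun x => t *: D x))}.
    by apply: continuousD; [exact: Gc|exact: tDc].
  by move=> x; exact: h.
move=> x; have [i Gx] := GAb x; have [j Dx] := DAb x.
exists (enum_rank (i, j)); rewrite /= enum_rankK Gx Dx /=.
rewrite mulmxDr -scalemxAr; move: (x *m _) (x *m _) => v w.
by apply/rowP => c; rewrite !mxE; ring.
Qed.

(** Extends the homotopy to all real parameters, where [constant_of_locally] applies; being
    1-Lipschitz, it preserves nearness of parameters. *)
Definition clamp (R : realType) (t : R) : R := Num.max 0 (Num.min t 1).

Lemma clamp_itv (R : realType) (t : R) : 0 <= clamp t <= 1.
Proof.
by rewrite le_max lexx ge_max ler01 ge_min lexx orbT.
Qed.

Lemma clamp_dist (R : realType) (s t : R) : `|clamp t - clamp s| <= `|t - s|.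
Proof.
rewrite /clamp ler_norml; case: (leP t 1) => h1; case: (leP s 1) => h2;
  rewrite ?(max_idPr (@ler01 R)); try (case: (leP 0 t) => h3);
  try (case: (leP 0 s) => h4); case: (ger0P (t - s)) => h5;
  by apply/andP; split; lra.
Qed.

(** The degree at nearby parameters is computed at one common value [y], stable under the
    perturbation. This [y] may depend on [s], because the degree does not depend on the regular
    value. *)
Lemma degree_homotopy (R : realType) (n : nat) (G D : 'rV[R]_n -> 'rV[R]_n) :
  piecewise_affine G -> piecewise_affine D ->
  (forall t, 0 <= t <= 1 -> coercive (fun x => G x + t *: D x)) ->
  degree (fun x => G x + 1 *: D x) = degree (fun x => G x + 0 *: D x).
Proof.
move=> GPA DPA co.
pose H (t : R) x := G x + t *: D x.
have HPA t : piecewise_affine (H t) by exact: piecewise_affine_perturb.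
have c0 : clamp 0 = 0 :> R by rewrite /clamp min_l ?ler01// maxxx.
have c1 : clamp 1 = 1 :> R by rewrite /clamp minxx max_r ?ler01.
suff : (degree (H (clamp 1)))%:~R = (degree (H (clamp 0)))%:~R :> R.
  by move=> /intr_inj; rewrite c0 c1.
apply: (@constant_of_locally _ (fun t => (degree (H (clamp t)))%:~R)) => s.
have [kG [AG [bG GAb]]] := GPA; have [kD [AD [bD DAb]]] := DPA.
have [k [A [b HAb]]] := HPA (clamp s).
have DHl : linearly_bounded D := composed_linearly_bounded DAb.
(* [y] is also generic for the pieces of [D], so that [D] is affine near every
   preimage of [y], even where the pieces of [G] and [D] cancel. *)
have [|j|y yP] := @composed_generic_value _ _ _ _ _ _
    ('I_kD * 'I_kD * 'I_n)%type (fun j => gap_fun AD bD j) HAb.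
- by move=> j; exact: gap_fun_affine.
- exact: gap_fun_neq0.
have yM x : H (clamp s) x = y -> exists2 M, M \in unitmx & affine_near (H (clamp s)) x M.
  by move=> /yP[].
have yreg := affine_regular_value yM.
have [yfin _] := regular_preimage HAb yreg.
have Daff x : H (clamp s) x = y -> exists P, affine_near D x P.
  move=> /yP[_ xg]; have [i Dx] := DAb.2 x; exists (AD i).
  exact: gap_fun_affine_near DAb xg Dx.
have := index_sum_stable HAb.1 (co _ (clamp_itv s)) DHl yfin yM Daff.
move=> /nbhs_norm_exP[r r0 rP]; apply/nbhs_norm_exP; exists r; first exact: r0.
move=> t tr; congr (_%:~R).
have [|H'M _ Hsum] := rP (clamp t - clamp s).
  by rewrite subr0 (le_lt_trans (clamp_dist _ _)).
have HE : (fun x => H (clamp s) x + (clamp t - clamp s) *: D x) = H (clamp t).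
  apply/funext => x; rewrite /H scalerBl; move: (G x) (D x) => v w.
  by apply/rowP => c; rewrite !mxE; ring.
have := affine_regular_value (G := fun x => _) H'M; rewrite HE => H'reg.
rewrite HE in Hsum.
rewrite (degree_index_sum (HPA _) (co _ (clamp_itv t)) H'reg) Hsum.
apply/esym.
exact: (degree_index_sum (HPA (clamp s)) (co _ (clamp_itv s)) yreg).
Qed.

(** * Growth of the difference of two models *)

Section Sweep.
Context (R : realType) (T : Type) (next : seq T -> instr R -> T).

Lemma size_sweep ins (p : seq (instr R)) :
  size (sweep next ins p) = (size ins + size p)%N.
Proof.
rewrite /sweep; elim: p ins => [|c p IH] ins /=; first by rewrite addn0.
by rewrite IH size_rcons addSnnS.
Qed.

Lemma take_sweep_inputs ins (p : seq (instr R)) :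
  take (size ins) (sweep next ins p) = ins.
Proof.
rewrite /sweep; elim: p ins => [|c p IH] ins /=; first by rewrite take_size.
have := IH (rcons ins (next ins c)); rewrite size_rcons => /(congr1 (take (size ins))).
by rewrite take_takel// -cats1 take_size_cat.
Qed.

Lemma sweep_cat ins (p p' : seq (instr R)) :
  sweep next ins (p ++ p') = sweep next (sweep next ins p) p'.
Proof. by rewrite /sweep foldl_cat. Qed.

Lemma nth_sweep_inputs d ins (p : seq (instr R)) j : (j < size ins)%N ->
  nth d (sweep next ins p) j = nth d ins j.
Proof. by move=> jn; rewrite -[in RHS](take_sweep_inputs ins p) nth_take. Qed.

Lemma nth_sweep d c0 ins (p : seq (instr R)) i : (i < size p)%N ->
  nth d (sweep next ins p) (size ins + i) =
  next (take (size ins + i) (sweep next ins p)) (nth c0 p i).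
Proof.
move=> ip; set c := nth c0 p i; set s := sweep next ins (take i p).
have E : sweep next ins p = sweep next (rcons s (next s c)) (drop i.+1 p).
  by rewrite -{1}(cat_take_drop i p) sweep_cat (drop_nth c0).
have ss : size s = (size ins + i)%N by rewrite size_sweep size_take ip.
have sE : take (size ins + i) (sweep next ins p) = s.
  have := take_sweep_inputs (rcons s (next s c)) (drop i.+1 p).
  rewrite -E size_rcons -ss => /(congr1 (take (size s))).
  by rewrite take_takel// -cats1 take_size_cat.
rewrite sE E nth_sweep_inputs; last by rewrite size_rcons ss.
by rewrite nth_rcons ss ltnn eqxx.
Qed.

End Sweep.

Section Procedure.
Context (R : realType) (n m : nat) (P : evaluation_procedure R n m).

Local Notation instruction i := (nth (Add 0 0) P i).

Lemma procedure_ind (Q : nat -> Prop) :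
  (forall j, (j < n)%N -> Q j) ->
  (forall i, (i < size P)%N -> (forall j, j \in instr_args (instruction i) -> Q j) ->
    Q (n + i)%N) ->
  forall j, (j < n + size P)%N -> Q j.
Proof.
move=> Qin Qstep j; elim/ltn_ind: j => j IH jN.
have [jn|nj] := ltnP j n; first exact: Qin.
have iP : (j - n < size P)%N by rewrite ltn_subLR.
rewrite -(subnKC nj); apply: Qstep => // j' j'a.
have := instrs_args iP j'a; rewrite subnKC// => j'j.
by apply: IH => //; exact: ltn_trans j'j jN.
Qed.

Lemma size_coords (x : 'rV[R]_n) : size (coords x) = n.
Proof. by rewrite size_map size_enum_ord. Qed.

Lemma nth_coords (x : 'rV[R]_n) (j : 'I_n) : (coords x)`_j = x ord0 j.
Proof. by rewrite (nth_map j) ?size_enum_ord// nth_ord_enum. Qed.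

Lemma values_input (x : 'rV[R]_n) (j : 'I_n) : (values P x)`_j = x ord0 j.
Proof. by rewrite /values nth_sweep_inputs ?size_coords// nth_coords. Qed.

Lemma values_step (x : 'rV[R]_n) i : (i < size P)%N ->
  (values P x)`_(n + i) = next_value (values P x) (instruction i).
Proof.
move=> iP; have := @instrs_args _ _ _ P i iP.
have := nth_sweep (@next_value R) 0 (Add 0 0) (coords x) iP.
rewrite size_coords -/(values P x) => ->.
by case: (instruction i) => [j k|j|phi j] args /=;
   rewrite ?nth_take// args// !inE eqxx ?orbT.
Qed.

Definition increments (xc xh dx : 'rV[R]_n) : seq R :=
  sweep (next_increment (values P xc) (values P xh)) (coords dx) P.

Lemma increments_input (xc xh dx : 'rV[R]_n) (j : 'I_n) :
  (increments xc xh dx)`_j = dx ord0 j.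
Proof. by rewrite /increments nth_sweep_inputs ?size_coords// nth_coords. Qed.

Lemma increments_step (xc xh dx : 'rV[R]_n) i : (i < size P)%N ->
  let mid j := ((values P xc)`_j + (values P xh)`_j) / 2 in
  let dv := increments xc xh dx in
  dv`_(n + i) = match instruction i with
    | Add j k => dv`_j + dv`_k
    | Abs j => `|mid j + dv`_j| - mid (n + i)%N
    | Smooth phi j => slope phi (values P xc)`_j (values P xh)`_j * dv`_j
    end.
Proof.
move=> iP mid dv; have := @instrs_args _ _ _ P i iP.
have := nth_sweep (next_increment (values P xc) (values P xh)) 0 (Add 0 0)
  (coords dx) iP.
rewrite size_coords -/(increments xc xh dx) -/dv => ->.
case: (instruction i) => [j k|j|phi j] args /=.
- by rewrite !nth_take// args// !inE eqxx ?orbT.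
(* [next_increment] reads the current position off the length of the prefix, which is [n + i]
   here. *)
- rewrite nth_take ?args ?inE// size_take size_sweep size_coords.
  by rewrite ltn_add2l iP.
- by rewrite nth_take// args// inE.
Qed.

Definition beta_const (K : set 'rV[R]_n) j : R := (nth (0, 0) (constants K P) j).1.
Definition gamma_const (K : set 'rV[R]_n) j : R := (nth (0, 0) (constants K P) j).2.

Lemma constants_input (K : set 'rV[R]_n) j : (j < n)%N ->
  beta_const K j = 1 /\ gamma_const K j = 0.
Proof.
move=> jn; rewrite /beta_const /gamma_const /constants nth_sweep_inputs ?size_nseq//.
by rewrite nth_nseq jn.
Qed.

Lemma constants_step (K : set 'rV[R]_n) i : (i < size P)%N ->
  nth (0, 0) (constants K P) (n + i) =
  next_constants K P (constants K P) (instruction i).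
Proof.
move=> iP; have := @instrs_args _ _ _ P i iP.
have := nth_sweep (next_constants K P) (0, 0) (Add 0 0) (nseq n (1, 0)) iP.
rewrite size_nseq -/(constants K P) => ->.
by case: (instruction i) => [j k|j|phi j] args /=;
   rewrite ?nth_take// args// !inE eqxx ?orbT.
Qed.

Lemma size_constants (K : set 'rV[R]_n) : size (constants K P) = (n + size P)%N.
Proof. by rewrite size_sweep size_nseq. Qed.

Lemma size_increments (xc xh dx : 'rV[R]_n) : size (increments xc xh dx) = (n + size P)%N.
Proof. by rewrite size_sweep size_coords. Qed.

End Procedure.

(** * Elementals on a compact convex set *)

Lemma convex_segment (R : realType) (n : nat) (K : set 'rV[R]_n) x y (t : R) :
  convex_set (K : set (convex_lmodType 'rV[R]_n)) -> K x -> K y -> 0 <= t <= 1 ->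
  K (x + t *: (y - x)).
Proof.
move=> Kc Kx Ky /andP[t0 t1].
have := Kc y x (Itv01 t0 t1); rewrite !inE => /(_ Ky Kx).
move=> Kt.
suff -> : x + t *: (y - x) = t *: y + (1 - t) *: x by exact: Kt.
by apply/rowP => i; rewrite !mxE; ring.
Qed.

Lemma lipschitz_globallyP (R : realType) (A : set R) (f : R -> R) (M : R) :
  (M.-lipschitz_A f) <-> (forall s t, A s -> A t -> `|f s - f t| <= M * `|s - t|).
Proof.
split=> [h s t As At|h [s t] [/= As At]]; last exact: h.
exact: (h (s, t)).
Qed.

Section Elemental.
Context (R : realType) (phi : elemental R).

Lemma elemental_is_derive t : edom phi t -> is_derive t 1 phi ((derive1 phi) t).
Proof.
by move=> dt; rewrite derive1E; apply/derivableP; exact: efun_derivable.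
Qed.

Lemma elemental_continuous t : edom phi t -> {for t, continuous phi}.
Proof.
move=> /(@efun_derivable _ phi)/derivable1_diffP.
exact: differentiable_continuous.
Qed.


Lemma elemental_derive_locally_lipschitz t : edom phi t ->
  exists2 U, nbhs t U & exists2 M, 0 <= M & forall s s', U s -> U s' ->
    `|(derive1 phi) s - (derive1 phi) s'| <= M * `|s - s'|.
Proof.
move=> /(@efun_derive_lipschitz _ phi)[U tU [M [_ MU]]]; exists U => //.
exists (`|M| + 1); first by rewrite addr_ge0.
apply/lipschitz_globallyP; apply: MU.
by rewrite (le_lt_trans (ler_norm _))// ltrDl.
Qed.

Lemma elemental_derive_continuous t : edom phi t -> {for t, continuous (derive1 phi)}.
Proof.
move=> /elemental_derive_locally_lipschitz[U tU [M M0 MU]].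
have M1 : 0 < M + 1 by rewrite ltr_wpDl.
apply/cvgrPdist_lt => e e0; have [r r0 rU] := (nbhs_norm_exP _ _).1 tU.
apply/(@nbhs_norm_exP R (R : normedModType R) t).
exists (Num.min r (e / (M + 1))).
  by rewrite lt_min r0 divr_gt0.
move=> s; rewrite lt_min => /andP[sr se].
rewrite ltr_pdivlMr// in se.
have Ut : U t by apply: rU; rewrite subrr normr0.
apply: le_lt_trans (MU _ _ Ut (rU _ sr)) _; rewrite distrC.
by apply: le_lt_trans se; rewrite mulrC ler_wpM2l// lerDl.
Qed.

(** Makes secant and tangent slopes uniform: both are values of the derivative between the two
    arguments. *)
Lemma slope_mean_value (x y : R) :
  (forall c, Num.min x y <= c <= Num.max x y -> edom phi c) ->
  exists2 c, Num.min x y <= c <= Num.max x y & slope phi x y = (derive1 phi) c.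
Proof.
have [->|xy] := eqVneq x y; rewrite /slope ?eqxx ?xy/=.
  move=> _; exists y; first by rewrite minxx maxxx lexx.
  by congr ((derive1 phi) _); field.
wlog lxy : x y xy / x < y => [H dom|].
  have := xy; rewrite neq_lt => /orP[lxy|lyx].
    exact: (H x y xy lxy dom).
  have yx : y != x by rewrite eq_sym.
  have [|c cxy cE] := H y x yx lyx.
    by move=> c; rewrite minC maxC; exact: dom.
  exists c; first by rewrite minC maxC.
  by rewrite -cE -[RHS]mulrNN -invrN !opprB.
rewrite (min_l (ltW lxy)) (max_r (ltW lxy)) => dom.
have [||c] := @MVT_segment _ phi (derive1 phi) x y (ltW lxy).
- move=> c; rewrite in_itv/= => /andP[xc cy].
  by apply: elemental_is_derive; apply: dom; rewrite !ltW.
- apply: continuous_in_subspaceT => c; rewrite inE/= in_itv/=.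
  by move=> /dom/elemental_continuous.
rewrite in_itv/= => cxy cE; exists c => //.
have yx0 : y - x != 0 by rewrite subr_eq0 eq_sym.
by rewrite -[RHS](mulfK yx0) -cE -[RHS]mulrNN -invrN !opprB.
Qed.

End Elemental.

(** Compactness of [K] times [K]: near a pair with equal values of [u] the local constant works;
    near any other pair the numerator is bounded and the denominator is bounded below. It makes the
    infimum in [lipschitz_constant] one over a nonempty set. *)
Lemma near_covering_lipschitz (R : realType) (X : pseudoMetricType R)
    (K : set X) (u : X -> R) (f : R -> R) (B : R) :
  compact K -> continuous u ->
  (forall z, K z -> `|f (u z)| <= B) ->
  (forall z, K z -> exists2 U, nbhs (u z) U & exists2 M, 0 <= M &
    forall s s', U s -> U s' -> `|f s - f s'| <= M * `|s - s'|) ->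
  exists2 M, 0 <= M & forall z z', K z -> K z' ->
    `|f (u z) - f (u z')| <= M * `|u z - u z'|.
Proof.
move=> Kc uc fB floc.
have KKc := (compact_near_coveringP _).1 (compact_setX Kc Kc).
have := KKc R (pinfty_nbhs R) (fun M zz => K zz.1 -> K zz.2 ->
  `|f (u zz.1) - f (u zz.2)| <= M * `|u zz.1 - u zz.2|) _.
case=> [[z z'] [/= Kz Kz']|M [_ MP]]; last first.
  exists (`|M| + 1); first by rewrite addr_ge0.
  move=> z z' Kz Kz'; apply: (MP (`|M| + 1) _ (z, z')) => //.
  by rewrite (le_lt_trans (ler_norm _))// ltrDl.
have [uzz'|uzz'] := eqVneq (u z) (u z').
  have [U Uz [M M0 MU]] := floc z Kz.
  exists ([set w | U (u w.1) /\ U (u w.2)], [set r | M < r]); last first.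
    move=> [[w w'] r] [/= [Uw Uw'] Mr] _ _.
    by apply: le_trans (MU _ _ Uw Uw') _; rewrite ler_wpM2r// ltW.
  split; last by exists M; split; rewrite ?num_real.
  exists ([set w | U (u w)], [set w | U (u w)]); last by move=> [w w'].
  by split; apply: uc => //; rewrite -uzz'.
pose d := `|u z - u z'|.
have d0 : 0 < d by rewrite normr_gt0 subr_eq0.
have d4 : 0 < d / 4 by rewrite divr_gt0.
(* In these neighbourhoods the values of [u] stay [d / 2] apart, while [f] varies by at most
   [2 * B]; hence the quotient [4 * B / d]. *)
exists ([set w | `|u z - u w.1| < d / 4 /\ `|u z' - u w.2| < d / 4],
        [set r | 4 * B / d < r]); last first.
  move=> [[w w'] r] [/= [dw dw'] rB] Kw Kw'.
  have := fB w Kw; have := fB w' Kw'.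
  rewrite ltr_pdivrMr// in rB.
  have B0 : 0 <= B := le_trans (normr_ge0 _) (fB z Kz).
  have dd : d / 2 <= `|u w - u w'|.
    have : d <= `|u z - u w| + `|u w - u w'| + `|u z' - u w'|.
      have h1 := ler_normD (u z - u w + (u w - u w')) (u w' - u z').
      have h2 := ler_normD (u z - u w) (u w - u w').
      rewrite (_ : u z - u w + (u w - u w') + _ = u z - u z') in h1; last by ring.
      by rewrite /d [`|u z' - _|]distrC; lra.
    lra.
  have r0 : 0 <= r by rewrite -(pmulr_lge0 _ d0); lra.
  move=> h1 h2; apply: le_trans (ler_normB _ _) _.
  have : r * (d / 2) <= r * `|u w - u w'| by rewrite ler_wpM2l.
  lra.
split; last by exists (4 * B / d); split; rewrite ?num_real.
exists ([set w | `|u z - u w| < d / 4], [set w | `|u z' - u w| < d / 4]).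
  by split; [have /cvgrPdist_lt := uc z|have /cvgrPdist_lt := uc z']; apply.
by move=> [w w'].
Qed.

Section Estimates.
Context (R : realType) (n m : nat) (P : evaluation_procedure R n m).
Context (K : set 'rV[R]_n) (K_compact : compact K).
Context (K_convex : convex_set (K : set (convex_lmodType 'rV[R]_n))).

Local Notation instruction i := (nth (Add 0 0) P i).
Local Notation u j := (fun x : 'rV[R]_n => (values P x)`_j).

Lemma instr_dom i phi j x : (i < size P)%N -> instruction i = Smooth phi j ->
  edom phi (u j x).
Proof. by move=> iP ij; exact: (instrs_dom iP ij). Qed.

Lemma values_continuous j : (j < n + size P)%N -> continuous (u j).
Proof.
move: j; apply: (@procedure_ind _ _ _ P) => [j jn|i iP IH].
  have -> : u j = (fun x : 'rV[R]_n => x ord0 (Ordinal jn)).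
    by apply/funext => x; rewrite -(values_input P x (Ordinal jn)).
  exact: coord_continuous.
have uE : u (n + i) = (fun x => next_value (values P x) (instruction i)).
  by apply/funext => x; rewrite values_step.
rewrite uE => x; case E : (instruction i) IH => [j k|j|phi j] /= IH.
- have jc : continuous (u j) by apply: IH; rewrite !inE eqxx.
  have kc : continuous (u k) by apply: IH; rewrite !inE eqxx orbT.
  exact: (cvgD (jc x) (kc x)).
- apply: (@continuous_comp _ _ _ (u j) Num.norm); last exact: norm_continuous.
  by apply: IH; rewrite inE.
- apply: (@continuous_comp _ _ _ (u j) phi); first by apply: IH; rewrite inE.
  exact: elemental_continuous (instr_dom x iP E).
Qed.

(** An intermediate value theorem along a segment of [K]. Mean value points thereby become values at
    points of [K], where the constants give bounds. *)
Lemma values_between j x y c : (j < n + size P)%N -> K x -> K y ->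
  Num.min (u j x) (u j y) <= c <= Num.max (u j x) (u j y) ->
  exists2 z, K z & u j z = c.
Proof.
move=> jP Kx Ky cxy; pose z t := x + t *: (y - x).
have zc : continuous z.
  move=> t; apply: cvgD; first exact: cvg_cst.
  by apply: cvgZl; exact: cvg_id.
have z0 : z 0 = x by rewrite /z scale0r addr0.
have z1 : z 1 = y by rewrite /z scale1r addrC subrK.
have [||t t01 tc] := @IVT _ (u j \o z) 0 1 c ler01.
- apply: continuous_subspaceT => t.
  exact: (continuous_comp (zc t) (values_continuous jP (x := z t))).
- by rewrite /= z0 z1.
exists (z t) => //; rewrite in_itv/= in t01; exact: convex_segment.
Qed.

Section SmoothInstruction.
Context (i : nat) (phi : elemental R) (j : nat).
Context (iP : (i < size P)%N) (iE : instruction i = Smooth phi j).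

Lemma smooth_arg : (j < n + size P)%N.
Proof.
have : (j < n + i)%N by apply: (instrs_args iP); rewrite iE inE.
by move=> /leq_trans; apply; rewrite leq_add2l ltnW.
Qed.

Let L := sup [set `|derive1 phi (u j x)| | x in K].
Let L' := lipschitz_constant [set u j x | x in K] (derive1 phi).

Lemma smooth_derive_bounded z : K z -> `|derive1 phi (u j z)| <= L.
Proof.
move=> Kz.
have dc : continuous (fun x => `|derive1 phi (u j x)|).
  move=> x; apply: (@continuous_comp _ _ _ (fun x => derive1 phi (u j x)) Num.norm).
    apply: (@continuous_comp _ _ _ (u j) (derive1 phi)).
      exact: values_continuous smooth_arg x.
    exact: elemental_derive_continuous (instr_dom x iP iE).
  exact: norm_continuous.
have K0 : K !=set0 by exists z.
have [x _ xmax] := EVT_max_rV K0 K_compact (continuous_subspaceT dc).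
apply: ub_le_sup; last by exists z.
by exists `|derive1 phi (u j x)| => _ [w Kw <-]; apply: xmax; rewrite inE.
Qed.

Lemma smooth_bound_ge0 : K !=set0 -> 0 <= L.
Proof. by move=> [z Kz]; exact: le_trans (normr_ge0 _) (smooth_derive_bounded Kz). Qed.

(** Every admissible constant bounds the difference quotient, so their infimum does as well. *)
Lemma smooth_derive_lipschitz z z' : K z -> K z' ->
  `|derive1 phi (u j z) - derive1 phi (u j z')| <= L' * `|u j z - u j z'|.
Proof.
move=> Kz Kz'; have [-> | uzz'] := eqVneq (u j z) (u j z').
  by rewrite !subrr normr0 mulr0.
have d0 : 0 < `|u j z - u j z'| by rewrite normr_gt0 subr_eq0.
rewrite -ler_pdivrMr//; apply: lb_le_inf.
  have [|M M0 MP] := near_covering_lipschitz K_compact (values_continuous smooth_arg)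
      smooth_derive_bounded.
    by move=> w Kw; exact: elemental_derive_locally_lipschitz (instr_dom w iP iE).
  exists M; split=> //; apply/lipschitz_globallyP => _ _ [w Kw <-] [w' Kw' <-].
  exact: MP.
move=> M [M0 /lipschitz_globallyP MP]; rewrite ler_pdivrMr//.
by apply: MP; [exists z|exists z'].
Qed.

Lemma smooth_lipschitz_ge0 : 0 <= L'.
Proof.
rewrite /L' /lipschitz_constant.
have [->|/eqP/set0P S0] := pselect ([set M | 0 <= M /\
    M.-lipschitz_[set u j x | x in K] (derive1 phi)] = set0).
  by rewrite inf0.
by apply: lb_le_inf => // M [].
Qed.

(** The last clause is used with [c] the value at the central point: the point of differentiation is
    no farther from it, in value, than the development points. *)
Lemma smooth_slope x y : K x -> K y -> exists z, [/\ K z,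
  slope phi (u j x) (u j y) = derive1 phi (u j z) &
  forall c, `|u j z - c| <= Num.max `|u j x - c| `|u j y - c|].
Proof.
move=> Kx Ky.
have [|c cxy cE] := @slope_mean_value _ phi (u j x) (u j y).
  move=> c /(values_between smooth_arg Kx Ky)[z _ <-].
  exact: (instr_dom z iP iE).
have [z Kz zc] := values_between smooth_arg Kx Ky cxy.
exists z; split => //; first by rewrite cE zc.
move=> d; rewrite zc; move: cxy; move: (u j x) (u j y) => a a' /andP[].
rewrite ge_min le_max le_max => /orP h1 /orP h2.
apply/orP; case: (lerP d c) => ha.
  case: h2 => h2; [left|right];
  by rewrite (le_trans _ (ler_norm _))// lerD2r.
case: h1 => h1; [left|right];
by rewrite distrC (le_trans _ (ler_norm _))// lerD2l lerN2.
Qed.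

Lemma smooth_constants :
  beta_const P K (n + i) = beta_const P K j * L /\
  gamma_const P K (n + i) = L * gamma_const P K j + L' * beta_const P K j ^+ 2.
Proof. by rewrite /beta_const /gamma_const constants_step// iE. Qed.

End SmoothInstruction.
End Estimates.

(** * What the recursive constants bound *)

Section Bounds.
Context (R : realType) (n m : nat) (P : evaluation_procedure R n m).
Context (K : set 'rV[R]_n) (K_compact : compact K).
Context (K_convex : convex_set (K : set (convex_lmodType 'rV[R]_n))).

Local Notation instruction i := (nth (Add 0 0) P i).
Local Notation u j x := (values P x)`_j.
Local Notation beta := (beta_const P K).
Local Notation gamma := (gamma_const P K).

Lemma add_constants i j k : (i < size P)%N -> instruction i = Add j k ->
  beta (n + i) = beta j + beta k /\ gamma (n + i) = gamma j + gamma k.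
Proof. by move=> iP iE; rewrite /beta_const /gamma_const !constants_step// iE. Qed.

Lemma abs_constants i j : (i < size P)%N -> instruction i = Abs j ->
  beta (n + i) = beta j /\ gamma (n + i) = gamma j.
Proof. by move=> iP iE; rewrite /beta_const /gamma_const !constants_step// iE. Qed.

Lemma constants_ge0 j : K !=set0 -> (j < n + size P)%N -> 0 <= beta j /\ 0 <= gamma j.
Proof.
move=> K0; move: j; apply: (@procedure_ind _ _ _ P) => [j jn|i iP].
  by have [-> ->] := constants_input P K jn; rewrite ler01 lexx.
case iE : (instruction i) => [j k|j|phi j] /= IH.
- have [-> ->] := add_constants iP iE.
  have [|bj gj] := IH j; first by rewrite inE eqxx.
  have [|bk gk] := IH k; first by rewrite !inE eqxx orbT.
  by rewrite !addr_ge0.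
- have [-> ->] := abs_constants iP iE.
  by apply: IH; rewrite inE.
- have [-> ->] := smooth_constants K iP iE.
  have [|bj gj] := IH j; first by rewrite inE.
  have L0 := smooth_bound_ge0 K_compact iP iE K0.
  have L'0 := smooth_lipschitz_ge0 P K phi j.
  by rewrite addr_ge0 ?mulr_ge0// exprn_ge0.
Qed.

Lemma values_lipschitz j x y : (j < n + size P)%N -> K x -> K y ->
  `|u j x - u j y| <= beta j * `|x - y|.
Proof.
move=> + Kx Ky; move: j; apply: (@procedure_ind _ _ _ P) => [j jn|i iP].
  have [-> _] := constants_input P K jn; rewrite mul1r.
  rewrite !(values_input P _ (Ordinal jn)) -row_subE.
  exact: ler_coord_norm.
have K0 : K !=set0 by exists x.
rewrite !values_step//; case iE : (instruction i) => [j k|j|phi j] /= IH.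
- have [-> _] := add_constants iP iE.
  have hj : `|u j x - u j y| <= beta j * `|x - y| by apply: IH; rewrite inE eqxx.
  have hk : `|u k x - u k y| <= beta k * `|x - y| by apply: IH; rewrite !inE eqxx orbT.
  rewrite opprD addrACA mulrDl (le_trans (ler_normD _ _))//.
  exact: lerD.
- have [-> _] := abs_constants iP iE.
  by apply: le_trans (ler_dist_dist _ _) _; apply: IH; rewrite inE.
- have [-> _] := smooth_constants K iP iE.
  have hj : `|u j x - u j y| <= beta j * `|x - y| by apply: IH; rewrite inE.
  have [z [Kz zE _]] := smooth_slope K_convex iP iE Kx Ky.
  have -> : phi (u j x) - phi (u j y) = derive1 phi (u j z) * (u j x - u j y).
    rewrite -zE /slope; have [->|xy] := eqVneq (u j x) (u j y).
      by rewrite !subrr mulr0.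
    by rewrite divfK// subr_eq0.
  rewrite normrM [X in _ <= X * _]mulrC -mulrA ler_pM//.
  exact: (smooth_derive_bounded K_compact iP iE Kz).
Qed.

(** The slopes obey the same bounds as the derivatives, so [beta] also controls the growth of
    increments; midpoints and base points enter only the additive constant. *)
Lemma increment_bound zc zh x0 j : K zc -> K zh -> (j < n + size P)%N ->
  exists C, 0 <= C /\
    forall x, `|(increments P zc zh (x - x0))`_j| <= beta j * `|x| + C.
Proof.
move=> Kc Kh; move: j; apply: (@procedure_ind _ _ _ P) => [j jn|i iP].
  exists `|x0|; split=> // x; have [-> _] := constants_input P K jn; rewrite mul1r.
  rewrite (increments_input P _ _ _ (Ordinal jn)).
  exact: le_trans (ler_coord_norm _ _) (ler_normB _ _).
have K0 : K !=set0 by exists zc.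
case iE : (instruction i) => [j k|j|phi j] /= IH.
- have [|Cj [Cj0 hj]] := IH j; first by rewrite inE eqxx.
  have [|Ck [Ck0 hk]] := IH k; first by rewrite !inE eqxx orbT.
  exists (Cj + Ck); split=> [|x]; first exact: addr_ge0.
  rewrite increments_step// iE; have [-> _] := add_constants iP iE.
  have := hj x; have := hk x => h1 h2.
  apply: le_trans (ler_normD _ _) _; lra.
- have [|Cj [Cj0 hj]] := IH j; first by rewrite inE.
  pose mid k := (u k zc + u k zh) / 2.
  exists (Cj + `|mid j| + `|mid (n + i)%N|); split=> [|x]; first by rewrite !addr_ge0.
  rewrite increments_step// iE -/(mid j) -/(mid (n + i)%N).
  have [-> _] := abs_constants iP iE.
  apply: le_trans (ler_normB _ _) _; rewrite normr_id.
  have := ler_normD (mid j) (increments P zc zh (x - x0))`_j.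
  have := hj x; lra.
- have [|Cj [Cj0 hj]] := IH j; first by rewrite inE.
  have [z [Kz zE _]] := smooth_slope K_convex iP iE Kc Kh.
  have zL := smooth_derive_bounded K_compact iP iE Kz.
  have L0 := smooth_bound_ge0 K_compact iP iE K0.
  set L := sup _ in zL L0.
  exists (L * Cj); split=> [|x]; first exact: mulr_ge0.
  rewrite increments_step// iE zE; have [-> _] := smooth_constants K iP iE.
  rewrite -/L normrM.
  apply: (@le_trans _ _ (L * (beta j * `|x| + Cj))); first by rewrite ler_pM.
  lra.
Qed.

(** The origin of the recursion for [gamma]: a change of slope, at most [L' * beta * r], multiplies
    an increment of growth [beta], giving the term in [beta ^+ 2], while the earlier discrepancy is
    multiplied by [L]. *)
Lemma increment_distance zc zh xo r x0 x1 j : K zc -> K zh -> K xo ->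
  `|zc - xo| <= r -> `|zh - xo| <= r -> (j < n + size P)%N ->
  exists C, 0 <= C /\ forall x,
    `|(increments P zc zh (x - x0))`_j - (increments P xo xo (x - x1))`_j| <=
    gamma j * r * `|x| + C.
Proof.
move=> Kc Kh Ko rc rh.
have r0 : 0 <= r := le_trans (normr_ge0 _) rc.
have K0 : K !=set0 by exists zc.
move: j; apply: (@procedure_ind _ _ _ P) => [j jn|i iP].
  exists `|x1 - x0|; split=> // x; have [_ ->] := constants_input P K jn.
  rewrite !mul0r add0r !(increments_input P _ _ _ (Ordinal jn)) -row_subE.
  have -> : x - x0 - (x - x1) = x1 - x0.
    by apply/rowP => c; rewrite !mxE; ring.
  exact: ler_coord_norm.
case iE : (instruction i) => [j k|j|phi j] /= IH.
- have [|Cj [Cj0 hj]] := IH j; first by rewrite inE eqxx.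
  have [|Ck [Ck0 hk]] := IH k; first by rewrite !inE eqxx orbT.
  exists (Cj + Ck); split=> [|x]; first exact: addr_ge0.
  rewrite !increments_step// iE; have [_ ->] := add_constants iP iE.
  rewrite opprD addrACA; apply: le_trans (ler_normD _ _) _.
  have := hj x; have := hk x; lra.
- have [|Cj [Cj0 hj]] := IH j; first by rewrite inE.
  pose mid k := (u k zc + u k zh) / 2.
  pose mido k := (u k xo + u k xo) / 2.
  exists (Cj + `|mid j - mido j| + `|mid (n + i)%N - mido (n + i)%N|).
  split=> [|x]; first by rewrite !addr_ge0.
  rewrite !increments_step// iE -/(mid j) -/(mid (n + i)%N) -/(mido j) -/(mido (n + i)%N).
  have [_ ->] := abs_constants iP iE.
  set s := (increments P zc zh _)`_j; set t := (increments P xo xo _)`_j.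
  have hst : `|s - t| <= gamma j * r * `|x| + Cj := hj x.
  have h1 := ler_dist_dist (mid j + s) (mido j + t).
  have h2 := ler_normD (mid j - mido j) (s - t).
  rewrite opprD addrACA in h1.
  have h3 := ler_normB (`|mid j + s| - `|mido j + t|)
    (mid (n + i)%N - mido (n + i)%N).
  rewrite (_ : _ - _ - (mid _ - _) = `|mid j + s| - mid (n + i)%N -
    (`|mido j + t| - mido (n + i)%N)) in h3; last by ring.
  lra.
- have [|Cj [Cj0 hj]] := IH j; first by rewrite inE.
  have [|bj gj] := @constants_ge0 j K0; first exact: smooth_arg iP iE.
  have [Dj [Dj0 hDj]] := increment_bound x1 Ko Ko (smooth_arg iP iE).
  have [z [Kz zE zd]] := smooth_slope K_convex iP iE Kc Kh.
  have [z' [Kz' z'E z'd]] := smooth_slope K_convex iP iE Ko Ko.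
  (* In tangent mode both development points coincide, so the mean value is the central value
     itself. *)
  have z'o : u j z' = u j xo.
    have := z'd (u j xo); rewrite subrr normr0 maxxx normr_le0 subr_eq0.
    by move/eqP.
  have zL := smooth_derive_bounded K_compact iP iE Kz.
  have L0 := smooth_bound_ge0 K_compact iP iE K0.
  have zL' := smooth_derive_lipschitz K_compact iP iE Kz Ko.
  have L'0 := smooth_lipschitz_ge0 P K phi j.
  have [_ gE] := smooth_constants K iP iE.
  set L := sup _ in zL L0 gE; set L' := lipschitz_constant _ _ in zL' L'0 gE.
  have jP := smooth_arg iP iE.
  have zr : `|u j z - u j xo| <= beta j * r.
    apply: le_trans (zd _) _; rewrite ge_max; apply/andP; split.
      by apply: le_trans (values_lipschitz jP Kc Ko) _; rewrite ler_wpM2l.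
    by apply: le_trans (values_lipschitz jP Kh Ko) _; rewrite ler_wpM2l.
  have Lbr0 : 0 <= L' * (beta j * r) by rewrite !mulr_ge0.
  exists (L * Cj + L' * (beta j * r) * Dj); split=> [|x].
    by rewrite addr_ge0// mulr_ge0.
  rewrite !increments_step// iE zE z'E z'o gE.
  set s := (increments P zc zh _)`_j; set t := (increments P xo xo _)`_j.
  have hst : `|s - t| <= gamma j * r * `|x| + Cj := hj x.
  have ht : `|t| <= beta j * `|x| + Dj := hDj x.
  set a := derive1 phi (u j z) in zL zL' *; set a' := derive1 phi (u j xo) in zL' *.
  have -> : a * s - a' * t = a * (s - t) + (a - a') * t by ring.
  have haa : `|a - a'| <= L' * (beta j * r).
    by apply: le_trans zL' _; rewrite ler_wpM2l.
  apply: le_trans (ler_normD _ _) _; rewrite !normrM.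
  have h1 : `|a| * `|s - t| <= L * (gamma j * r * `|x| + Cj) by rewrite ler_pM.
  have h2 : `|a - a'| * `|t| <= L' * (beta j * r) * (beta j * `|x| + Dj).
    by rewrite ler_pM.
  lra.
Qed.

End Bounds.

(** * The models are piecewise affine *)

(** A scalar form with an unstructured list of functionals, closed under the operations of the
    increment recursion; vector pieces are assembled only at the end. *)
Definition affine_selection (R : realType) (n : nat) (f : 'rV[R]_n -> R) : Prop :=
  continuous f /\ exists s : seq ('cV[R]_n * R),
    forall x, exists2 p, p \in s & f x = wall p.1 p.2 x.

Section AffineSelection.
Context (R : realType) (n : nat).
Implicit Types f g : 'rV[R]_n -> R.

Lemma affine_selection_wall (v : 'cV[R]_n) (c : R) : affine_selection (wall v c).
Proof.
split; first exact: wall_continuous.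
by exists [:: (v, c)] => x; exists (v, c); rewrite ?mem_head.
Qed.

Lemma affine_selection_cst (c : R) : affine_selection (fun _ : 'rV[R]_n => c).
Proof.
have -> : (fun=> c) = wall (0 : 'cV[R]_n) c.
  by apply/funext => x; rewrite /wall mulmx0 mxE add0r.
exact: affine_selection_wall.
Qed.

Lemma affine_selection_add f g : affine_selection f -> affine_selection g ->
  affine_selection (fun x => f x + g x).
Proof.
move=> [fc [s fs]] [gc [t gt]]; split.
  by move=> x; exact: (cvgD (fc x) (gc x)).
exists [seq (p.1 + q.1, p.2 + q.2) | p <- s, q <- t] => x.
have [p ps fp] := fs x; have [q qt gq] := gt x.
exists (p.1 + q.1, p.2 + q.2); first by apply/allpairsP; exists (p, q).
rewrite fp gq /wall /= mulmxDr; move: (x *m p.1) (x *m q.1) => v w.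
by rewrite [in RHS]mxE addrACA.
Qed.

Lemma affine_selection_scale (c : R) f : affine_selection f ->
  affine_selection (fun x => c * f x).
Proof.
move=> [fc [s fs]]; split.
  by move=> x; exact: (cvgMr (fc x)).
exists [seq wall_scale c p | p <- s] => x; have [p ps fp] := fs x.
by exists (wall_scale c p); rewrite ?map_f// wall_scaleE fp.
Qed.

Lemma affine_selection_abs f : affine_selection f ->
  affine_selection (fun x => `|f x|).
Proof.
move=> [fc [s fs]]; split.
  by move=> x; exact: (cvg_norm (fc x)).
exists (s ++ [seq wall_scale (-1) p | p <- s]) => x; have [p ps fp] := fs x.
have [f0|f0] := lerP 0 (f x).
  by exists p; rewrite ?mem_cat ?ps// ger0_norm.
exists (wall_scale (-1) p); first by rewrite mem_cat map_f ?orbT.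
by rewrite wall_scaleE -fp ltr0_norm// mulN1r.
Qed.

Lemma affine_selection_coords (m : nat) (G : 'rV[R]_n -> 'rV[R]_m) :
  (forall i, affine_selection (fun x => G x ord0 i)) -> piecewise_affine G.
Proof.
move=> Gs.
have [s sP] : {s : 'I_m -> seq ('cV[R]_n * R) & forall i x,
    exists2 p, p \in s i & G x ord0 i = wall p.1 p.2 x}.
  by apply: (@choice _ _ (fun i s => forall x, exists2 p, p \in s &
    G x ord0 i = wall p.1 p.2 x)) => i; have [] := Gs i.
pose S := flatten [seq s i | i <- enum 'I_m].
(* A vector piece chooses one functional for each coordinate independently. *)
pose T := {ffun 'I_m -> 'I_(size S)}.
pose piece (t : T) i := nth 0 S (t i).
exists #|{: T}|, (fun k => \matrix_(l, c) (piece (enum_val k) c).1 l ord0),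
  (fun k => \row_c (piece (enum_val k) c).2).
split; first by apply: continuous_coords => i; have [] := Gs i.
move=> x.
have [t tP] : {t : 'I_m -> 'I_(size S) & forall i,
    G x ord0 i = wall (nth 0 S (t i)).1 (nth 0 S (t i)).2 x}.
  apply: (@choice _ _ (fun (i : 'I_m) (k : 'I_(size S)) =>
    G x ord0 i = wall (nth 0 S k).1 (nth 0 S k).2 x)).
  move=> i; have [p ps Gp] := sP i x.
  have pS : p \in S.
    by apply/flattenP; exists (s i) => //; rewrite map_f// mem_enum.
  have kS : (index p S < size S)%N by rewrite index_mem.
  by exists (Ordinal kS); rewrite /= nth_index.
exists (enum_rank [ffun i => t i]); apply/rowP => c.
rewrite tP /wall !mxE enum_rankK /piece ffunE; congr (_ + _).
by apply: eq_bigr => l _; rewrite mxE ffunE.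
Qed.

End AffineSelection.

Lemma increments_affine_selection (R : realType) (n m : nat)
    (P : evaluation_procedure R n m) (zc zh x0 : 'rV[R]_n) j :
  (j < n + size P)%N ->
  affine_selection (fun x => (increments P zc zh (x - x0))`_j).
Proof.
move: j; apply: (@procedure_ind _ _ _ P) => [j jn|i iP].
  have -> : (fun x => (increments P zc zh (x - x0))`_j) =
      wall (delta_mx (Ordinal jn) 0) (- x0 ord0 (Ordinal jn)).
    apply/funext => x; rewrite (increments_input P _ _ _ (Ordinal jn)) row_subE.
    by rewrite /wall -colE mxE.
  exact: affine_selection_wall.
under eq_fun do rewrite increments_step//.
case: (nth (Add 0 0) P i) => [j k|j|phi j] IH.
- by apply: affine_selection_add; apply: IH; rewrite !inE eqxx ?orbT.
- apply: affine_selection_add; last exact: affine_selection_cst.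
  apply: affine_selection_abs; apply: affine_selection_add.
    exact: affine_selection_cst.
  by apply: IH; rewrite inE.
- by apply: affine_selection_scale; apply: IH; rewrite inE.
Qed.

Lemma last_index_lt (R : realType) (n m : nat) (P : evaluation_procedure R n m)
    (i : 'I_m) : (n + size P - m + i < n + size P)%N.
Proof.
have mP := instrs_outputs P; rewrite -{2}(subnK mP) ltn_add2l.
exact: ltn_ord.
Qed.

Lemma secant_model_coord (R : realType) (n m : nat) (P : evaluation_procedure R n m)
    (zc zh x : 'rV[R]_n) (i : 'I_m) :
  secant_model P zc zh x ord0 i =
  (2^-1 *: (evaluate P zc + evaluate P zh)) ord0 i +
  (increments P zc zh (x - 2^-1 *: (zc + zh)))`_(n + size P - m + i).
Proof.
rewrite /secant_model [LHS]mxE; congr (_ + _).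
rewrite /increment /last_items mxE -/(increments _ _ _ _).
by rewrite size_increments.
Qed.

Lemma secant_piecewise_affine (R : realType) (n m : nat)
    (P : evaluation_procedure R n m) (zc zh : 'rV[R]_n) :
  piecewise_affine (secant_model P zc zh).
Proof.
apply: affine_selection_coords => i.
under eq_fun do rewrite secant_model_coord.
apply: affine_selection_add; first exact: affine_selection_cst.
exact: increments_affine_selection (last_index_lt P i).
Qed.

Lemma secant_distance (R : realType) (n m : nat) (P : evaluation_procedure R n m)
    (K : set 'rV[R]_n) (zc zh xo : 'rV[R]_n) (r : R) :
  compact K -> convex_set (K : set (convex_lmodType 'rV[R]_n)) ->
  K zc -> K zh -> K xo -> `|zc - xo| <= r -> `|zh - xo| <= r ->
  exists C, forall x, `|secant_model P zc zh x - tangent_model P xo x| <=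
    second_order_constant P K * r * `|x| + C.
Proof.
move=> Kcpt Kcvx Kc Kh Ko rc rh.
have r0 : 0 <= r := le_trans (normr_ge0 _) rc.
pose c0 := 2^-1 *: (evaluate P zc + evaluate P zh).
pose c1 := 2^-1 *: (evaluate P xo + evaluate P xo).
pose x0 := 2^-1 *: (zc + zh); pose x1 := 2^-1 *: (xo + xo).
pose N (i : 'I_m) := (n + size P - m + i)%N.
have [C C_] : {C : 'I_m -> R & forall i, 0 <= C i /\ forall x,
    `|(increments P zc zh (x - x0))`_(N i) - (increments P xo xo (x - x1))`_(N i)| <=
    gamma_const P K (N i) * r * `|x| + C i}.
  apply: (@choice _ _ (fun i C => 0 <= C /\ forall x,
    `|(increments P zc zh (x - x0))`_(N i) - (increments P xo xo (x - x1))`_(N i)| <=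
    gamma_const P K (N i) * r * `|x| + C)) => i.
  exact: (increment_distance Kcpt Kcvx x0 x1 Kc Kh Ko rc rh (last_index_lt P i)).
have gF i : gamma_const P K (N i) <= second_order_constant P K.
  have -> : gamma_const P K (N i) =
      last_items m [seq bg.2 | bg <- constants K P] ord0 i.
    rewrite /last_items mxE size_map size_constants (nth_map (0, 0)) ?size_constants//.
    exact: last_index_lt.
  exact: le_bigmax.
have gF0 : 0 <= second_order_constant P K by exact: bigmax_ge_id.
exists (`|c0 - c1| + \sum_i C i) => x.
have C0 : 0 <= \sum_i C i by apply: sumr_ge0 => i _; have [] := C_ i.
apply: ler_norm_coord => [|i]; first by rewrite !addr_ge0// !mulr_ge0.
rewrite row_subE !secant_model_coord -/c0 -/c1 -/x0 -/x1 -/(N i).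
rewrite opprD addrACA; apply: le_trans (ler_normD _ _) _.
have h1 : `|c0 ord0 i - c1 ord0 i| <= `|c0 - c1|.
  by rewrite -row_subE ler_coord_norm.
have [_ /(_ x) h2] := C_ i.
have h3 : C i <= \sum_i C i.
  by rewrite (bigD1 i)//= lerDl sumr_ge0// => j _; have [] := C_ j.
have h4 : gamma_const P K (N i) * r * `|x| <= second_order_constant P K * r * `|x|.
  by rewrite !ler_wpM2r.
lra.
Qed.

(** * Induced norms and the admissible radius *)

Lemma induced_norm_has_ubound (R : realType) (n : nat) (A : 'M[R]_n) :
  has_ubound [set `|x *m A| | x in [set x : 'rV[R]_n | `|x| <= 1]].
Proof.
have [C C0 AC] := mulmx_bounded A; exists C => _ [x /= x1 <-].
by apply: le_trans (AC x) _; rewrite ler_piMr// ltW.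
Qed.

Lemma ler_induced_norm (R : realType) (n : nat) (A : 'M[R]_n) (x : 'rV[R]_n) :
  `|x *m A| <= induced_norm A * `|x|.
Proof.
have [->|x0] := eqVneq x 0; first by rewrite mul0mx !normr0 mulr0.
have nx : 0 < `|x| by rewrite normr_gt0.
rewrite -ler_pdivrMr//; apply: ub_le_sup; first exact: induced_norm_has_ubound.
exists (`|x|^-1 *: x) => /=.
  by rewrite normrZ normfV normr_id mulVf ?gt_eqF.
by rewrite -scalemxAl normrZ normfV normr_id mulrC.
Qed.

Lemma induced_norm_gt0 (R : realType) (n : nat) (A : 'M[R]_n) :
  (0 < n)%N -> A \in unitmx -> 0 < induced_norm A.
Proof.
move=> n0 Au; pose x : 'rV[R]_n := delta_mx 0 (Ordinal n0).
have x0 : x != 0.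
  by apply/eqP => /rowP/(_ (Ordinal n0)); rewrite !mxE !eqxx => /eqP; rewrite oner_eq0.
have : 0 < `|x *m A|.
  rewrite normr_gt0; apply: contraNneq x0 => xA.
  by rewrite -[x](mulmxK Au) xA mul0mx.
move=> /lt_le_trans/(_ (ler_induced_norm A x)).
by rewrite pmulr_lgt0// normr_gt0.
Qed.

Lemma ler_inv_induced_norm (R : realType) (n : nat) (A : 'M[R]_n) (x : 'rV[R]_n) :
  A \in unitmx -> (induced_norm (invmx A))^-1 * `|x| <= `|x *m A|.
Proof.
move=> Au; have [N0|N0] := ltP 0 (induced_norm (invmx A)); last first.
  by apply: le_trans (normr_ge0 _); rewrite mulr_le0_ge0// invr_le0.
rewrite mulrC ler_pdivrMr// mulrC -{1}[x](mulmxK Au).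
exact: ler_induced_norm.
Qed.

(** Trades the extended radius for a real [rho]: a lower growth bound for every piece, still
    strictly larger than [g] times the distance of the development points. *)
Lemma coercivity_radius (R : realType) (n k : nat) (A : 'I_k -> 'M[R]_n)
    (g : R) (x z z' : 'rV[R]_n) :
  0 <= g -> (forall i, A i \in unitmx) ->
  open_ball x (quotient_radius (min_inv_norm A) g) z ->
  open_ball x (quotient_radius (min_inv_norm A) g) z' ->
  exists2 rho, g * Num.max `|z - x| `|z' - x| < rho &
    forall i (v : 'rV[R]_n), rho * `|v| <= `|v *m A i|.
Proof.
move=> g0 Au xz xz'; set d := Num.max _ _.
have [n0|n0] := posnP n.
  (* In dimension 0 the induced norm is 0, and so is its inverse. *)
  exists (g * d + 1); first by rewrite ltrDl.
  by subst n => i v; rewrite (thinmx0 v) mul0mx !normr0 mulr0.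
have gd i : g * d < (induced_norm (invmx (A i)))^-1.
  have N0 : 0 < (induced_norm (invmx (A i)))^-1.
    by rewrite invr_gt0 induced_norm_gt0// unitmx_inv.
  have [->|gn0] := eqVneq g 0; first by rewrite mul0r.
  have gp : 0 < g by rewrite lt_neqAle eq_sym gn0.
  have ball w : open_ball x (quotient_radius (min_inv_norm A) g) w ->
      g * `|w - x| < (induced_norm (invmx (A i)))^-1.
    rewrite /open_ball /= /quotient_radius (negPf gn0) distrC => xw.
    rewrite mulrC -ltr_pdivlMr// -lte_fin EFinM; apply: lt_le_trans xw _.
    by rewrite lee_wpmul2r// ?lee_fin ?invr_ge0//; exact: bigmin_le.
  by rewrite maxr_pMr// gt_max; apply/andP; split; exact: ball.
(* The default [g * d + 1] replaces the infinite neutral element and keeps the minimum strictly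
   above [g * d]. *)
exists (\big[Num.min/g * d + 1]_i (induced_norm (invmx (A i)))^-1).
  by apply: lt_bigmin => [|i _]; [rewrite ltrDl|exact: gd].
move=> i v; apply: le_trans (ler_inv_induced_norm v (Au i)).
by rewrite ler_wpM2r//; exact: bigmin_le.
Qed.

Lemma composed_coercive_lower_bound (R : realType) (n k : nat)
    (G : 'rV[R]_n -> 'rV[R]_n) (A : 'I_k -> 'M[R]_n) (b : 'I_k -> 'rV[R]_n)
    (rho : R) :
  composed_of G A b -> (forall i (v : 'rV[R]_n), rho * `|v| <= `|v *m A i|) ->
  exists C, forall x, rho * `|x| <= `|G x| + C.
Proof.
move=> [_ GAb] rhoA; exists (\sum_i `|b i|) => x; have [i ->] := GAb x.
apply: le_trans (rhoA i x) _.
rewrite -{1}[x *m A i](addrK (b i)) (le_trans (ler_normB _ _))// lerD2l.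
by rewrite (bigD1 i)//= lerDl sumr_ge0.
Qed.

Theorem proposition3p4 (R : realType) (n : nat)
    (F : evaluation_procedure R n n)
    (K : set 'rV[R]_n)
    (K_compact : compact K)
    (K_convex : convex_set (K : set (convex_lmodType 'rV[R]_n)))
    (K_neighbourhood : K° !=set0)
    (xo : 'rV[R]_n) (xo_K : K xo)
    (k : nat) (A : 'I_k -> 'M[R]_n) (b : 'I_k -> 'rV[R]_n)
    (tangent_composed : composed_of (tangent_model F xo) A b)
    (A_invertible : forall i, A i \in unitmx) :
  let gammaF := second_order_constant F K in
  let rhoF := min_inv_norm A in
  let U := K `&` open_ball xo (quotient_radius rhoF gammaF) in
  (forall zo : 'rV[R]_n, U zo ->
     degree_well_defined (tangent_model F zo) /\
     degree (tangent_model F zo) = degree (tangent_model F xo)) /\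
  (forall zc zh : 'rV[R]_n, U zc -> U zh ->
     degree_well_defined (secant_model F zc zh) /\
     degree (secant_model F zc zh) = degree (tangent_model F xo)).
Proof.
move=> gammaF rhoF U.
(* A tangent model is by definition the secant model with equal development points. *)
suff secant zc zh : U zc -> U zh ->
    degree_well_defined (secant_model F zc zh) /\
    degree (secant_model F zc zh) = degree (tangent_model F xo).
  by split=> [zo Uz|//]; exact: secant.
move=> [Kc Bc] [Kh Bh].
have g0 : 0 <= gammaF by exact: bigmax_ge_id.
have [rho grho rhoA] := coercivity_radius g0 A_invertible Bc Bh.
set r := Num.max _ _ in grho.
have rc : `|zc - xo| <= r by rewrite le_max lexx.
have rh : `|zh - xo| <= r by rewrite le_max lexx orbT.
have [C SC] := secant_distance F K_compact K_convex Kc Kh xo_K rc rh.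
have [C' TC] := composed_coercive_lower_bound tangent_composed rhoA.
set S := secant_model F zc zh in SC *; set T := tangent_model F xo in TC *.
pose D x := S x + (-1) *: T x.
have TPA : piecewise_affine T by exact: secant_piecewise_affine.
have SPA : piecewise_affine S by exact: secant_piecewise_affine.
have DPA : piecewise_affine D by exact: piecewise_affine_perturb.
have co t : 0 <= t <= 1 -> coercive (fun x => T x + t *: D x).
  (* The growth rate of [T] minus that of [D], valid for all parameters since [t <= 1]. *)
  move=> /andP[t0 t1]; exists (rho - gammaF * r), (C + C').
  split=> [|x]; first by rewrite subr_gt0.
  have Dx : `|D x| <= gammaF * r * `|x| + C by rewrite /D scaleN1r; exact: SC.
  have tD : `|t *: D x| <= `|D x| by rewrite normrZ ger0_norm// ler_piMl.
  have : `|T x| <= `|T x + t *: D x| + `|t *: D x|.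
    by rewrite -{1}[T x](addrK (t *: D x)) ler_normB.
  have := TC x; lra.
have S1 : (fun x => T x + 1 *: D x) = S.
  by apply/funext => x; rewrite /D scale1r scaleN1r addrC subrK.
have T0 : (fun x => T x + 0 *: D x) = T.
  by apply/funext => x; rewrite scale0r addr0.
have Sco : coercive S by rewrite -S1; apply: co; rewrite ler01 lexx.
split; first exact: coercive_degree_well_defined.
by rewrite -{1}S1 -[in RHS]T0; exact: degree_homotopy.
Qed.
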